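(* Let $\mathbb G\leq \mathrm{Aut}(X,\mu)$ be an ergodic full group, and let $\tau$ be a Hausdorff SIN group topology on $\mathbb G$. Then $\tau$ is either the discrete topology or the uniform topology.
   Context: $(X,\mu)$ is an atomless standard probability space. $\mathrm{Aut}(X,\mu)$ is the group of measure-preserving Borel bijections of $(X,\mu)$ up to equality almost everywhere. A full group is a subgroup $\mathbb G\leq\mathrm{Aut}(X,\mu)$ stable under countable cutting and pasting: whenever $(A_k)$ is a countable measurable partition of $X$ and $T_k\in\mathbb G$ are such that $(T_k(A_k))$ is also a partition of $X$, the map $T$ given by $T(x)=T_k(x)$ for $x\in A_k$ belongs to $\mathbb G$. It is ergodic if the only $\mathbb G$-invariant measurable sets up to null sets are $\emptyset$ and $X$. The uniform topology on $\mathbb G$ is the topology induced by the metric $d_u(S,T)=\mu(\{x\in X\colon S(x)\neq T(x)\})$. A group topology is SIN (small invariant neighborhoods) if there is a basis of neighborhoods of the identity consisting of conjugacy-invariant neighborhoods. *)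

(* Defs.v *)
From HB Require Import structures.
From mathcomp Require Import all_boot all_order all_algebra.
From mathcomp Require Import generic_quotient lra.
From mathcomp Require Import all_classical all_reals all_analysis.

Set Implicit Arguments.
Unset Strict Implicit.
Unset Printing Implicit Defensive.
Import Order.TTheory GRing.Theory Num.Theory.

Local Open Scope classical_set_scope.
Local Open Scope ring_scope.

Obligation Tactic := idtac.

(** A standard Borel space only remembers the sigma-algebra: the Polish metric
    generating it is existentially quantified and carried on the same type. *)

Definition separable (P : topologicalType) : Prop :=
  exists2 D : set P, countable D & dense D.

Definition complete_metric (R : realType) (P : metricType R) : Prop :=
  forall F : set_system P, ProperFilter F -> cauchy F ->
    exists x : P, F --> x.

Definition polish_sigma_algebra (R : realType) (T : Type) (S : set (set T)) :=
  exists M : Metric R T, let P : metricType R := Metric.Pack M in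
    [/\ separable P, complete_metric P & S = <<s @open P >>].

HB.mixin Record isStandardBorel (R : realType) d T & Measurable d T := {
  standard_borelP : polish_sigma_algebra R (@measurable d T)
}.

#[short(type="standardBorelType")]
HB.structure Definition StandardBorel (R : realType) d :=
  {T of Measurable d T & isStandardBorel R d T}.

Definition atomless d (T : measurableType d) (R : realType)
    (mu : probability T R) : Prop :=
  forall A, measurable A -> (0 < mu A)%E ->
    exists B, [/\ measurable B, B `<=` A, (0 < mu B)%E & (mu B < mu A)%E].

(** Borel bijections are Borel isomorphisms.  The inverse is recorded as data;
    this is harmless since the elements of [Aut mu] below only depend on the
    underlying function up to a.e. equality. *)

Section MeasurePreservingBijections.
Context d (T : measurableType d) (R : realType) (mu : probability T R).

Record mpbij := MpBij {
  mpbij_fun :> T -> T;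
  mpbij_inv : T -> T;
  mpbijK : cancel mpbij_fun mpbij_inv;
  mpbij_invK : cancel mpbij_inv mpbij_fun;
  measurable_mpbij : measurable_fun [set: T] mpbij_fun;
  measurable_mpbij_inv : measurable_fun [set: T] mpbij_inv;
  mpbij_preserving :
    forall A, measurable A -> mu (mpbij_fun @^-1` A) = mu A
}.

HB.instance Definition _ := gen_eqMixin mpbij.
HB.instance Definition _ := gen_choiceMixin mpbij.

Program Definition mpbij_id : mpbij := @MpBij id id _ _ _ _ _.
Next Obligation. by []. Qed.
Next Obligation. by []. Qed.
Next Obligation. exact: measurable_id. Qed.
Next Obligation. exact: measurable_id. Qed.
Next Obligation. by []. Qed.

Program Definition mpbij_comp (f g : mpbij) : mpbij :=
  @MpBij (f \o g) (mpbij_inv g \o mpbij_inv f) _ _ _ _ _.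
Next Obligation. by move=> f g x /=; rewrite !mpbijK. Qed.
Next Obligation. by move=> f g x /=; rewrite !mpbij_invK. Qed.
Next Obligation.
by move=> f g; apply: measurableT_comp; exact: measurable_mpbij.
Qed.
Next Obligation.
by move=> f g; apply: measurableT_comp; exact: measurable_mpbij_inv.
Qed.
Next Obligation.
move=> f g A mA; rewrite comp_preimage !mpbij_preserving//.
by rewrite -[_ @^-1` _]setTI; exact: measurable_mpbij.
Qed.

Program Definition mpbij_sym (f : mpbij) : mpbij :=
  @MpBij (mpbij_inv f) f _ _ _ _ _.
Next Obligation. exact: mpbij_invK. Qed.
Next Obligation. exact: mpbijK. Qed.
Next Obligation. exact: measurable_mpbij_inv. Qed.
Next Obligation. exact: measurable_mpbij. Qed.
Next Obligation.
move=> f A mA; rewrite -(mpbij_preserving f).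
  by congr (mu _); apply/seteqP; split => x /=; rewrite mpbijK.
by rewrite -[_ @^-1` _]setTI; exact: measurable_mpbij_inv.
Qed.

Definition mpbij_eq : rel mpbij :=
  fun f g => `[< (f : T -> T) = g %[ae mu] >].

Lemma mpbij_eqP (f g : mpbij) :
  reflect (\forall x \ae mu, f x = g x) (mpbij_eq f g).
Proof.
by apply: (iffP (asboolP _)) => [] fg; apply: filterS fg => x // /(_ I).
Qed.

Let mpbij_eq_refl : reflexive mpbij_eq.
Proof. by move=> f; apply/mpbij_eqP; exact: aeW. Qed.

Let mpbij_eq_sym : symmetric mpbij_eq.
Proof.
by move=> f g; apply/idP/idP => /mpbij_eqP fg; apply/mpbij_eqP;
  apply: filterS fg.
Qed.

Let mpbij_eq_trans : transitive mpbij_eq.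
Proof.
move=> g f h /mpbij_eqP fg /mpbij_eqP gh; apply/mpbij_eqP.
by apply: filterS2 fg gh => x ->.
Qed.

Canonical mpbij_eq_canonical :=
  EquivRel mpbij_eq mpbij_eq_refl mpbij_eq_sym mpbij_eq_trans.

Lemma mpbij_ae_preimage (f : mpbij) (P : T -> Prop) :
  (\forall x \ae mu, P x) -> \forall x \ae mu, P (f x).
Proof.
move=> [N [mN N0 PN]]; exists (f @^-1` N); split.
- by rewrite -[_ @^-1` _]setTI; exact: measurable_mpbij.
- by rewrite mpbij_preserving.
- by move=> x /PN.
Qed.

Lemma mpbij_eq_comp (f f' g g' : mpbij) : mpbij_eq f f' -> mpbij_eq g g' ->
  mpbij_eq (mpbij_comp f g) (mpbij_comp f' g').
Proof.
move=> /mpbij_eqP /(mpbij_ae_preimage g) ff /mpbij_eqP gg; apply/mpbij_eqP.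
by apply: filterS2 ff gg => x /= -> ->.
Qed.

Lemma mpbij_eq_inv (f g : mpbij) : mpbij_eq f g ->
  mpbij_eq (mpbij_sym f) (mpbij_sym g).
Proof.
move=> /mpbij_eqP /(mpbij_ae_preimage (mpbij_sym f)) fg; apply/mpbij_eqP.
apply: filterS fg => x /=; rewrite mpbij_invK => {2}->.
by rewrite mpbijK.
Qed.

(** The product is composition on representatives: (S * U)(x) = S (U x). *)

Local Open Scope quotient_scope.

Definition Aut : Type := {eq_quot mpbij_eq}.
HB.instance Definition _ := Choice.on Aut.
HB.instance Definition _ := EqQuotient.on Aut.

Definition aut_class (f : mpbij) : Aut := \pi_Aut f.

Lemma aut_classP (f g : mpbij) :
  aut_class f = aut_class g <-> \forall x \ae mu, f x = g x.
Proof. by split => [/eqmodP/mpbij_eqP|fg]; last exact/eqmodP/mpbij_eqP. Qed.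

Lemma aut_reprK (S : Aut) : aut_class (repr S) = S.
Proof. exact: reprK. Qed.

Definition aut_one : Aut := aut_class mpbij_id.
Definition aut_mul (S U : Aut) : Aut :=
  aut_class (mpbij_comp (repr S) (repr U)).
Definition aut_inv (S : Aut) : Aut := aut_class (mpbij_sym (repr S)).

Lemma aut_mulE (f g : mpbij) :
  aut_mul (aut_class f) (aut_class g) = aut_class (mpbij_comp f g).
Proof.
by apply/eqmodP/mpbij_eq_comp; apply/mpbij_eqP/aut_classP; rewrite aut_reprK.
Qed.

Lemma aut_invE (f : mpbij) : aut_inv (aut_class f) = aut_class (mpbij_sym f).
Proof.
by apply/eqmodP/mpbij_eq_inv; apply/mpbij_eqP/aut_classP; rewrite aut_reprK.
Qed.

Let aut_mulA : associative aut_mul.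
Proof.
move=> S U V; rewrite -(aut_reprK S) -(aut_reprK U) -(aut_reprK V) !aut_mulE.
by apply/aut_classP; exact: aeW.
Qed.

Let aut_mul1 : left_id aut_one aut_mul.
Proof.
by move=> S; rewrite -(aut_reprK S) aut_mulE; apply/aut_classP; exact: aeW.
Qed.

Let aut_mulr1 : right_id aut_one aut_mul.
Proof.
by move=> S; rewrite -(aut_reprK S) aut_mulE; apply/aut_classP; exact: aeW.
Qed.

Let aut_mulV : left_inverse aut_one aut_inv aut_mul.
Proof.
move=> S; rewrite -(aut_reprK S) aut_invE aut_mulE.
by apply/aut_classP/aeW => x /=; rewrite mpbijK.
Qed.

Let aut_mulrV : right_inverse aut_one aut_inv aut_mul.
Proof.
move=> S; rewrite -(aut_reprK S) aut_invE aut_mulE.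
by apply/aut_classP/aeW => x /=; rewrite mpbij_invK.
Qed.

HB.instance Definition _ := isGroup.Build Aut
  aut_mulA aut_mul1 aut_mulr1 aut_mulV aut_mulrV.

End MeasurePreservingBijections.

Definition subgroup (gT : groupType) (G : groupClosed gT) : Type :=
  {x : gT | x \in G}.

Section Subgroup.
Context (gT : groupType) (G : groupClosed gT).

HB.instance Definition _ := Choice.on (subgroup G).
HB.instance Definition _ := SubType.on (subgroup G).

Let subgroup_closed : group_closed G.
Proof. by split; [exact: gpred1|exact: gpredF]. Qed.

HB.instance Definition _ :=
  SubChoice_isSubGroup.Build gT [eta mem G] (subgroup G) subgroup_closed.

End Subgroup.

(** Partitions and glued maps are taken pointwise, for arbitrary representatives
    [S k] of classes in [G].  This agrees with the reading up to null sets: a null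
    set that is invariant under all the [S k] can be absorbed by changing
    representatives on it. *)

Section FullGroups.
Context d (T : measurableType d) (R : realType) (mu : probability T R).

Definition full_group (G : groupClosed (Aut mu)) : Prop :=
  forall (D : set nat) (A : nat -> set T) (S : nat -> mpbij mu),
    (forall k, D k -> measurable (A k)) ->
    (forall k, D k -> aut_class (S k) \in G) ->
    partition D A [set: T] ->
    partition D (fun k => S k @` A k) [set: T] ->
    forall t : T -> T, (forall k x, D k -> A k x -> t x = S k x) ->
      exists2 f : mpbij mu, (f : T -> T) = t & aut_class f \in G.

Definition invariant_set (G : groupClosed (Aut mu)) (A : set T) : Prop :=
  forall f : mpbij mu, aut_class f \in G -> mu ((f @` A) `+` A) = 0%E.

Definition ergodic (G : groupClosed (Aut mu)) : Prop :=
  forall A, measurable A -> invariant_set G A ->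
    mu A = 0%E \/ mu (~` A) = 0%E.

End FullGroups.

(** Without a standard Borel structure, [disagree S U] need not be measurable and
    [dist_u] below would not be a metric. *)

Section UniformDistance.
Context (R : realType) d (T : standardBorelType R d) (mu : probability T R).

Definition disagree (f g : T -> T) : set T := [set x | f x <> g x].

Lemma measurable_disagree (f g : T -> T) :
  measurable_fun [set: T] f -> measurable_fun [set: T] g ->
  measurable (disagree f g).
Proof.
move=> mf mg; have [M [[D cD dD] _ mE]] := @standard_borelP R d T.
set P : metricType R := Metric.Pack M in D cD dD mE.
pose B (a : P) n : set T := [set x | mdist a (x : P) < n.+1%:R^-1].
have mB a n : measurable (B a n).
  rewrite mE; apply: sub_sigma_algebra.
  rewrite (_ : B a n = ball (a : P) n.+1%:R^-1); last by rewrite ballEmdist.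
  rewrite openE => x; rewrite ballEmdist /= => ax.
  apply/nbhs_ballP; exists (n.+1%:R^-1 - mdist a (x : P)) => /=.
    by rewrite subr_gt0.
  move=> y; rewrite !ballEmdist /= ltrBrDl => xy.
  exact: le_lt_trans (metric_triangle _ _ _) xy.
rewrite (_ : disagree f g =
    \bigcup_n \bigcup_(a in D) ((f @^-1` B a n) `\` (g @^-1` B a n))).
  apply: bigcupT_measurable => n; rewrite bigcup_set_type; apply: countable_bigcupT_measurable => [|a].
    by rewrite (eq_countable (card_setT D)).
  apply: measurableD; rewrite -[_ @^-1` _]setTI; [exact: mf|exact: mg].
apply/seteqP; split => [x fg|x [n _ [a _ []]] + + fg]; last first.
  by rewrite /B /= fg.
have e0 : 0 < mdist (f x : P) (g x : P) by rewrite mdist_gt0; apply/eqP.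
have [n _ nP] := near_infty_natSinv_lt (PosNum (divr_gt0 e0 (ltr0n _ 2))).
have {nP} /= n2 := nP n (leqnn n).
have [||a [/= fa Da]] := dD (ball (f x : P) n.+1%:R^-1).
- by exists (f x); exact: ballxx.
- rewrite openE => y; rewrite ballEmdist /= => ay.
  apply/nbhs_ballP; exists (n.+1%:R^-1 - mdist (f x : P) y) => /=.
    by rewrite subr_gt0.
  move=> z; rewrite !ballEmdist /= ltrBrDl => xy.
  exact: le_lt_trans (metric_triangle _ _ _) xy.
move: fa; rewrite ballEmdist /= => fa.
exists n => //; exists a => //; split; rewrite /B /=.
  by rewrite metric_sym.
move=> ga; have := metric_triangle (f x : P) a (g x).
clear - n2 fa ga.
by move: (mdist _ _) (mdist _ _) (mdist _ _) _^-1 n2 fa ga => *; lra.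
Qed.

Definition dist_u (S U : Aut mu) : R := fine (mu (disagree (repr S) (repr U))).

Let mD (S U : mpbij mu) : measurable (disagree S U).
Proof. by apply: measurable_disagree; exact: measurable_mpbij. Qed.

Let le_disagree (f g f' g' : mpbij mu) :
  aut_class f = aut_class f' -> aut_class g = aut_class g' ->
  (mu (disagree f g) <= mu (disagree f' g'))%E.
Proof.
move=> /aut_classP [N [mN N0 Nf]] /aut_classP [N' [mN' N'0 Ng]].
have NN0 : mu (N `|` N') = 0%E.
  apply/negligibleP; first exact: measurableU.
  by apply: negligibleU; exact/negligibleP.
have mNN : measurable (N `|` N') by exact: measurableU.
rewrite -[leRHS]adde0 -NN0; apply: le_trans (measureU2 _ _ _) => //.
apply: le_measure; rewrite ?inE//; first exact: measurableU.
move=> x fg; have [fx|/Nf] := pselect (f x = f' x); last by right; left.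
have [gx|/Ng] := pselect (g x = g' x); last by right; right.
by left; rewrite /disagree /= -fx -gx.
Qed.

Lemma dist_uE (f g : mpbij mu) :
  dist_u (aut_class f) (aut_class g) = fine (mu (disagree f g)).
Proof.
by congr fine; apply/eqP; rewrite eq_le !le_disagree ?aut_reprK.
Qed.

Lemma dist_uxx S : dist_u S S = 0.
Proof.
by rewrite /dist_u (_ : disagree _ _ = set0) ?measure0//; apply/seteqP; split.
Qed.

Lemma dist_u_eq0 S U : dist_u S U = 0 -> S = U.
Proof.
move=> /eqP; rewrite /dist_u fine_eq0 ?fin_num_measure// => /eqP SU.
rewrite -(aut_reprK S) -(aut_reprK U); apply/aut_classP.
by exists (disagree (repr S) (repr U)); split; first exact: mD.
Qed.

Lemma dist_uC S U : dist_u S U = dist_u U S.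
Proof.
by congr (fine (mu _)); apply/seteqP; split => x /nesym.
Qed.

Lemma dist_u_triangle U S V : dist_u S V <= dist_u S U + dist_u U V.
Proof.
rewrite /dist_u -fineD ?fin_num_measure// fine_le ?fin_numD ?fin_num_measure//.
apply: le_trans (measureU2 _ _ _) => //.
apply: le_measure; rewrite ?inE//; first exact: measurableU.
move=> x SV; have [SU|] := pselect (repr S x = repr U x); last by left.
by right; rewrite /disagree /= -SU.
Qed.

End UniformDistance.

(** An alias of [subgroup G], so that [dist_u] does not become the canonical
    metric of the latter. *)
Definition uniform_group (R : realType) d (T : standardBorelType R d)
  (mu : probability T R) (G : groupClosed (Aut mu)) : Type := subgroup G.

Section UniformGroup.
Context (R : realType) d (T : standardBorelType R d) (mu : probability T R).
Context (G : groupClosed (Aut mu)).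

HB.instance Definition _ := Choice.on (uniform_group G).

Let dist (S U : uniform_group G) : R := dist_u (val S) (val U).

Let distxx S : dist S S = 0. Proof. exact: dist_uxx. Qed.
Let dist_eq0 S U : dist S U = 0 -> S = U.
Proof. by move=> /dist_u_eq0 /val_inj. Qed.
Let distC S U : dist S U = dist U S. Proof. exact: dist_uC. Qed.
Let dist_triangle U S V : dist S V <= dist S U + dist U V.
Proof. exact: dist_u_triangle. Qed.

HB.instance Definition _ := isMetric.Build R (uniform_group G)
  distxx dist_eq0 distC dist_triangle.

Definition uniform_topology : Topological (subgroup G) :=
  Topological.class (uniform_group G).

End UniformGroup.

Definition open_sets (X : Type) (tau : Topological X) : set (set X) :=
  @open (Topological.Pack tau).

Section GroupTopologies.
Context (gT : groupType) (tau : Topological gT).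
Let X : topologicalType := Topological.Pack tau.

Definition group_topology : Prop :=
  continuous (fun p : X * X => ((p.1 : gT) * (p.2 : gT))%g : X) /\
  continuous (fun x : X => ((x : gT)^-1)%g : X).

Definition SIN_topology : Prop :=
  forall U : set X, nbhs (1%g : X) U ->
    exists V : set X, [/\ nbhs (1%g : X) V, V `<=` U &
      forall x g : gT, V x -> V (x ^ g)%g].

End GroupTopologies.

(* Main.v *)
Require Import Defs.
From HB Require Import structures.
From mathcomp Require Import all_boot all_order all_algebra.
From mathcomp Require Import lra.
From mathcomp Require Import all_classical all_reals all_analysis.

Set Implicit Arguments.
Unset Strict Implicit.
Unset Printing Implicit Defensive.
Import Order.TTheory GRing.Theory Num.Theory.
Local Open Scope classical_set_scope.
Local Open Scope ring_scope.

(** Measure the size of an element g of the full group by the mass of the set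
    [moved g] of points that it moves; the uniform distance from g to 1 is that
    mass.  Two facts about an ergodic full group carry the proof.

    Small involutions are commutators.  Ergodicity makes any two disjoint sets
    of equal mass exchangeable by an involution of the group ([transport]), so
    that involutions with disjoint supports of equal mass are conjugate
    ([conjugate_involutions]).  If g moves a set of mass a, then g sends some
    set A with mass at least a / 3 off itself; for an involution h supported in
    A, the commutator of h and g is h times a disjoint copy of h, hence an
    involution of prescribed size.  So all involutions of size at most a / 16
    are conjugate to commutators of g ([commutator_involution]).  When g lies
    in a conjugation-invariant neighbourhood V of 1, these commutators lie in
    V V^-1, which therefore contains all involutions of size at most a / 16
    ([nbhs_involutions]).

    Small elements are products of few small involutions.  An element g of size
    b <= 1 / 7 is, up to conjugation, a product of five involutions of size at
    most 6 b ([five_involutions]).  An involution s_0 is split off so that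
    g = s_0 g_1 with g_1 of size at most 2 b / 3, and this is repeated forever:
    g_i = s_i g_(i+1).  The g_i are copied to pairwise disjoint rooms E_i of
    total mass 3 b.  Let F be the infinite product of the copies of g_i in E_i,
    H that of the copies of g_(i+1) in E_i, and Q that of the copies of g_(i+1)
    in E_(i+1).  Then F = S H, where the copies of the s_i in E_i form a single
    involution S, and F = g' Q, where g' is the copy of g in E_0.  Moreover H
    and Q are conjugate by a product of two involutions, which shift the copies
    by one room through a second family of rooms.  Hence g' = S H Q^-1 is the
    product of S and of a commutator of Q with the two shifting involutions.

    The dichotomy follows.  If elements of size at least e existed arbitrarily
    close to 1, then every neighbourhood of 1 would contain all involutions of
    size at most e / 16, against the Hausdorff property: hence the topology
    refines the uniform one ([nbhs_support_mass]).  If the topology is not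
    discrete, every neighbourhood of 1 contains some g <> 1, hence, after
    shrinking it, all small involutions, and their products of five factors: it
    contains a uniform ball ([uniform_ball_nbhs]). *)

(** * An order-theoretic exhaustion principle *)

(** The Brezis-Browder principle, which replaces the usual exhaustion arguments
    of measure theory: increasing sequences built by almost reaching a supremum
    at each step have upper bounds at which the supremum is attained. *)
Lemma maximal_value (R : realType) (S : Type) (le : S -> S -> Prop)
    (phi : S -> R) (M : R) :
  (forall x, le x x) -> (forall x y z, le x y -> le y z -> le x z) ->
  (forall x y, le x y -> phi x <= phi y) -> (forall x, phi x <= M) ->
  (forall u : nat -> S, (forall n, le (u n) (u n.+1)) ->
    exists y, forall n, le (u n) y) ->
  forall x0, exists2 x, le x0 x & forall y, le x y -> phi y <= phi x.
Proof.
move=> le_refl le_trans phi_le phiM chain x0.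
pose E x := [set phi y | y in le x].
have supE x : has_sup (E x).
  by split; [exists (phi x); exists x|exists M => _ [y _ <-]].
have next (p : nat * S) : {q : nat * S |
    [/\ q.1 = p.1.+1, le p.2 q.2 & sup (E p.2) - p.1.+1%:R^-1 < phi q.2]}.
  apply: cid; case: p => n x /=.
  have n0 : 0 < n.+1%:R^-1 :> R by rewrite invr_gt0 ltr0n.
  by have [_ [y xy <-] ?] := sup_adherent n0 (supE x); exists (n.+1, y).
have [u [u0 uS]] := dependent_choice next (0%N, x0).
have u1 n : (u n).1 = n.
  by elim: n => [|n IH]; [rewrite u0|have [-> _ _] := uS n; rewrite IH].
have [|y uy] := chain (fun n => (u n).2).
  by move=> n; have [_ ] := uS n.
exists y => [|z yz]; first by have := uy 0%N; rewrite u0.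
apply/ler_addgt0Pr => e e0.
have [n _ nP] := near_infty_natSinv_lt (PosNum e0).
have {nP} /= ne := nP n (leqnn n).
have [_ _] := uS n; rewrite u1 => supn.
have zn : phi z <= sup (E (u n).2).
  apply: ub_le_sup; [by case: (supE (u n).2)|].
  by exists z => //; exact: le_trans yz.
have /= := phi_le _ _ (uy n.+1).
move: (n.+1%:R^-1) ne supn => i ne supn; lra.
Qed.

(** * Real-valued measure of sets *)
Section Mass.
Context d (T : measurableType d) (R : realType) (mu : probability T R).

Definition mass (A : set T) : R := fine (mu A).

Lemma massE A : measurable A -> mu A = (mass A)%:E.
Proof. by move=> mA; rewrite /mass fineK// fin_num_measure. Qed.

Lemma mass_ge0 A : 0 <= mass A.
Proof. by rewrite fine_ge0. Qed.

Lemma mass_set0 : mass set0 = 0.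
Proof. by rewrite /mass measure0. Qed.

Lemma mass_setT : mass setT = 1.
Proof. by rewrite /mass probability_setT. Qed.

Lemma le_mass A B : measurable A -> measurable B -> A `<=` B ->
  mass A <= mass B.
Proof.
by move=> mA mB AB; rewrite fine_le ?fin_num_measure// le_measure ?inE.
Qed.

Lemma massU A B : measurable A -> measurable B -> A `<=` ~` B ->
  mass (A `|` B) = mass A + mass B.
Proof.
rewrite -disjoints_subset => mA mB AB.
by rewrite /mass measureU// fineD// fin_num_measure.
Qed.

Lemma massD A B : measurable A -> measurable B -> B `<=` A ->
  mass (A `\` B) = mass A - mass B.
Proof.
move=> mA mB BA; apply/eqP; rewrite eq_sym subr_eq; apply/eqP.
rewrite -massU; [|exact: measurableD|by []|by move=> x []].
by congr mass; rewrite setUC setDUK.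
Qed.

Lemma massID A B : measurable A -> measurable B ->
  mass A = mass (A `&` B) + mass (A `\` B).
Proof.
move=> mA mB; rewrite -massU; [|exact: measurableI|exact: measurableD|].
  by rewrite setUIDK.
by move=> x [_ Bx] [].
Qed.

Lemma massC A : measurable A -> mass (~` A) = 1 - mass A.
Proof. by move=> mA; rewrite -setTD massD// mass_setT. Qed.

Lemma mass_leU A B : measurable A -> measurable B ->
  mass (A `|` B) <= mass A + mass B.
Proof.
move=> mA mB; rewrite /mass -fineD ?fin_num_measure// fine_le//.
- by rewrite fin_num_measure//; exact: measurableU.
- by rewrite fin_numD !fin_num_measure.
- exact: measureU2.
Qed.

Lemma mass_bigcup_le (F : nat -> set T) c : (forall n, measurable (F n)) ->
  (forall n, F n `<=` F n.+1) -> (forall n, mass (F n) <= c) ->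
  mass (\bigcup_n F n) <= c.
Proof.
move=> mF FS Fc.
have mU : measurable (\bigcup_n F n) by exact: bigcupT_measurable.
rewrite -lee_fin -massE//.
have /cvg_lim <- // : mu \o F @ \oo --> mu (\bigcup_n F n).
  apply: nondecreasing_cvg_mu => //; apply/nondecreasing_seqP => n.
  exact/subsetPset.
apply: lime_le; last by apply: nearW => n /=; rewrite massE// lee_fin.
apply: ereal_nondecreasing_is_cvgn; apply/nondecreasing_seqP => n /=.
by rewrite le_measure ?inE.
Qed.

Lemma mass_bigcup0 (F : nat -> set T) : (forall n, measurable (F n)) ->
  (forall n, mass (F n) = 0) -> mass (\bigcup_n F n) = 0.
Proof.
move=> mF F0; rewrite /mass.
have /negligibleP -> // : mu.-negligible (\bigcup_n F n).
  apply: negligible_bigcup => n; apply/negligibleP => //.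
  by rewrite -[LHS]/(mu (F n)) massE// F0.
exact: bigcupT_measurable.
Qed.

Lemma measurable_bij (f : mpbij mu) A : measurable A -> measurable (f @^-1` A).
Proof. by move=> mA; rewrite -[_ @^-1` _]setTI; exact: measurable_mpbij. Qed.

Lemma mass_preimage (f : mpbij mu) A : measurable A ->
  mass (f @^-1` A) = mass A.
Proof. by move=> mA; rewrite /mass mpbij_preserving. Qed.

Lemma symK (f : mpbij mu) : cancel f (mpbij_sym f).
Proof. exact: mpbijK. Qed.

Lemma symKV (f : mpbij mu) : cancel (mpbij_sym f) f.
Proof. exact: mpbij_invK. Qed.

End Mass.

(** * Gluing elements of a full group *)
Section FullGroup.
Context (R : realType) d (T : standardBorelType R d) (mu : probability T R).
Context (G : groupClosed (Aut mu)).

Definition moved (f : T -> T) : set T := [set x | f x <> x].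

Lemma measurable_moved (f : mpbij mu) : measurable (moved f).
Proof.
apply: (@measurable_disagree R d T f id); last exact: measurable_id.
exact: measurable_mpbij.
Qed.

Definition in_group (f : mpbij mu) : Prop := aut_class f \in G.

Lemma in_group_id : in_group (mpbij_id mu).
Proof. by rewrite /in_group; apply: gpred1. Qed.

Lemma in_group_comp f g : in_group f -> in_group g ->
  in_group (mpbij_comp f g).
Proof. by rewrite /in_group -aut_mulE => fG gG; apply: gpredM. Qed.

Lemma in_group_sym f : in_group f -> in_group (mpbij_sym f).
Proof. by rewrite /in_group -aut_invE => fG; apply: gpredVr. Qed.

(** The pieces form a countable set of pairs instead of a sequence, so that
    countable unions of pieces raise no question of reindexing; they may
    overlap. *)
Definition locally_in (B : set T) (t : T -> T) : Prop :=
  exists Z : set (set T * mpbij mu), [/\ countable Z,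
    forall z, Z z -> [/\ measurable z.1, in_group z.2 &
      forall x, z.1 x -> t x = z.2 x] &
    forall x, B x -> exists2 z, Z z & z.1 x].

Lemma locally_in1 (B : set T) (f : mpbij mu) (t : T -> T) : measurable B ->
  in_group f -> (forall x, B x -> t x = f x) -> locally_in B t.
Proof.
move=> mB fG tf; exists [set (B, f)]; split=> [|z ->//|x Bx].
  exact: finite_set_countable.
by exists (B, f).
Qed.

Lemma locally_in_bigcup (B : nat -> set T) (t : T -> T) :
  (forall n, locally_in (B n) t) -> locally_in (\bigcup_n B n) t.
Proof.
move=> /choice[Z ZP]; exists (\bigcup_n Z n); split.
- by apply: bigcup_countable => // n _; have [] := ZP n.
- by move=> z [n _ Zz]; have [_ + _] := ZP n; exact.
- move=> x [n _ Bx]; have [_ _ /(_ x Bx)[z Zz zx]] := ZP n.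
  by exists z => //; exists n.
Qed.

Lemma locally_inU (A B : set T) (t : T -> T) :
  locally_in A t -> locally_in B t -> locally_in (A `|` B) t.
Proof.
move=> At Bt; rewrite -bigcup2E; apply: locally_in_bigcup => -[|[|n]] //=.
apply: (@locally_in1 _ (mpbij_id mu)) => //; exact: in_group_id.
Qed.

Context (G_full : full_group G).

(** The pieces become a partition after removing from each one the earlier
    ones, and the empty pieces are dropped because partitions consist of
    nonempty sets.  That the images of the pieces again form a partition is
    exactly the bijectivity of t. *)
Lemma glue (t t' : T -> T) : cancel t t' -> cancel t' t ->
  locally_in setT t -> exists2 f : mpbij mu, in_group f & forall x, f x = t x.
Proof.
move=> tK t'K [Z [cZ ZP ZT]].
have [Z0|[e]] := pfcard_geP cZ.
  have tid x : t x = x by have [z] := ZT x I; rewrite Z0.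
  by exists (mpbij_id mu) => [|x]; [exact: in_group_id|rewrite tid].
have eP k : [/\ measurable (e k).1, in_group (e k).2 &
    forall x, (e k).1 x -> t x = (e k).2 x].
  by apply: ZP; exact: funS.
pose A := seqDU (fun k => (e k).1).
have Ae k x : A k x -> (e k).1 x by case.
have mA k : measurable (A k).
  apply: measurableD; first by have [] := eP k.
  by apply: bigsetU_measurable => i _; have [] := eP i.
have cA x : exists k, A k x.
  have [z Zz zx] := ZT x I; have [k _ ek] := @surj _ _ _ _ e z Zz.
  have : (\bigcup_k (e k).1) x by exists k => //; rewrite ek.
  by rewrite seqDU_bigcup_eq => -[n _ An]; exists n.
have tA : trivIset setT A by exact: trivIset_seqDU.
pose D := [set k | A k !=set0].
have imA k x : ((e k).2 @` A k) x = A k (t' x).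
  rewrite propeqE; have [_ _ te] := eP k; split.
    by move=> [y Ay <-]; rewrite -te ?tK//; exact: Ae.
  by move=> Ax; exists (t' x) => //; rewrite -te ?t'K//; exact: Ae.
have [//|k _|||k x _ /Ae Akx|f ft fG] :=
  @G_full D A (fun k => (e k).2) _ _ _ _ t.
- by have [] := eP k.
- split => //; last by move=> i j _ _; exact: tA.
  apply/seteqP; split => // x _; have [k Ak] := cA x.
  by exists k => //; exists x.
- split.
  + apply/seteqP; split => // x _; have [k Ak] := cA (t' x).
    by exists k => //; [exists (t' x)|rewrite imA].
  + move=> i j _ _ [x []]; rewrite !imA => Ai Aj.
    by apply: tA => //; exists (t' x).
  + by move=> k [x Ak]; exists (t x); rewrite imA tK.
- by have [_ _ ->] := eP k.
- by exists f => // x; rewrite ft.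
Qed.

Lemma moved_stable (f : mpbij mu) x : moved f x -> moved f (f x).
Proof. by move=> fx /(can_inj (symK f)). Qed.

Lemma moved_sym (f : mpbij mu) x : moved f x -> moved (mpbij_sym f) x.
Proof. by move=> fx xE; apply: fx; rewrite -{1}xE symKV. Qed.

Lemma moved_symV (f : mpbij mu) x : moved (mpbij_sym f) x -> moved f x.
Proof. by move=> fx xE; apply: fx; rewrite -{1}xE symK. Qed.

(** For maps with pairwise disjoint supports this is their infinite product;
    for an increasing sequence of maps it is their union. *)
Definition pasted (f : nat -> mpbij mu) (F : mpbij mu) : Prop :=
  (forall n x, moved (f n) x -> F x = f n x) /\
  (forall x, (forall n, f n x = x) -> F x = x).

(** Agreement of the inverses is what makes the pasted map injective; its
    inverse is pasted from the inverses. *)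
Lemma glue_moved (f : nat -> mpbij mu) : (forall n, in_group (f n)) ->
  (forall n m x, moved (f n) x -> moved (f m) x -> f n x = f m x) ->
  (forall n m x, moved (f n) x -> moved (f m) x ->
     mpbij_sym (f n) x = mpbij_sym (f m) x) ->
  exists2 F : mpbij mu, in_group F & pasted f F.
Proof.
move=> fG ff fVf.
have glued (g : nat -> mpbij mu) :
    (forall n m x, moved (g n) x -> moved (g m) x -> g n x = g m x) ->
    {t : T -> T | (forall n x, moved (g n) x -> t x = g n x) /\
      (forall x, (forall n, g n x = x) -> t x = x)}.
  move=> gg; apply: cid.
  have /choice[t tP] : forall x, exists y,
      (forall n, moved (g n) x -> y = g n x) /\
      ((forall n, g n x = x) -> y = x).
    move=> x; have [[n gnx]|xg] := pselect (exists n, moved (g n) x).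
      exists (g n x); split=> [m gmx|gx]; [exact: gg|exact: gx].
    by exists x; split=> // n gnx; case: xg; exists n.
  by exists t; split=> [n x|x] ; have [] := tP x; auto.
have [t [tf tid]] := glued f ff.
have [|t' [t'f t'id]] := glued (fun n => mpbij_sym (f n)).
  by move=> n m x /moved_symV fn /moved_symV fm; exact: fVf.
have fix_or_moved x : (forall n, f n x = x) \/ exists n, moved (f n) x.
  by apply: contrapT => /not_orP[/existsNP[n fn] []]; exists n.
have tK : cancel t t'.
  move=> x; have [fx|[n fn]] := fix_or_moved x.
    by rewrite tid// t'id// => n; rewrite -{1}(fx n) symK.
  rewrite (tf n)// (t'f n) ?symK//.
  exact/moved_sym/moved_stable.
have t'K : cancel t' t.
  move=> x; have [fx|[n fn]] := fix_or_moved x.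
    by rewrite t'id ?tid// => n; rewrite -{1}(fx n) symK.
  rewrite (t'f n) ?(tf n) ?symKV//; last exact: moved_sym.
  exact/moved_symV/moved_stable/moved_sym.
have [|F FG Ft] := glue tK t'K.
  have -> : setT = (\bigcup_n moved (f n)) `|` ~` (\bigcup_n moved (f n)).
    by rewrite setUv.
  apply: locally_inU.
    apply: locally_in_bigcup => n.
    by apply: (locally_in1 (measurable_moved (f n)) (fG n)) => x; exact: tf.
  apply: (@locally_in1 _ (mpbij_id mu)).
  - apply: measurableC; apply: bigcupT_measurable => n.
    exact: measurable_moved.
  - exact: in_group_id.
  - move=> x xf; apply: tid => n; apply: contrapT => fn.
    by apply: xf; exists n.
by exists F => //; split=> [n x|x]; rewrite Ft; auto.
Qed.

Lemma glue_disjoint (E : nat -> set T) (f : nat -> mpbij mu) :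
  (forall n, in_group (f n)) -> trivIset setT E ->
  (forall n, moved (f n) `<=` E n) ->
  exists2 F : mpbij mu, in_group F & pasted f F.
Proof.
move=> fG tE fE.
have eq_nm n m x : moved (f n) x -> moved (f m) x -> n = m.
  by move=> /fE En /fE Em; apply: tE => //; exists x.
apply: glue_moved => // n m x fn fm; by rewrite (eq_nm _ _ _ fn fm).
Qed.

Lemma pastedE (E : nat -> set T) (f : nat -> mpbij mu) F n x :
  trivIset setT E -> (forall n, moved (f n) `<=` E n) -> pasted f F ->
  E n x -> F x = f n x.
Proof.
move=> tE fE [Ff Fid] Enx.
have [fnx|] := pselect (f n x = x); last exact: Ff.
rewrite fnx Fid// => m; have [//|fm] := pselect (f m x = x).
by have -> : m = n by apply: tE => //; exists x; split=> //; exact: fE.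
Qed.

Lemma moved_pasted (f : nat -> mpbij mu) F :
  pasted f F -> moved F `<=` \bigcup_n moved (f n).
Proof.
move=> [Ff Fid] x Fx; apply: contrapT => nfx; apply: Fx; apply: Fid => n.
by apply: contrapT => fx; apply: nfx; exists n.
Qed.

Lemma glue_invol (f : nat -> mpbij mu) :
  (forall n, in_group (f n)) -> (forall n, involutive (f n)) ->
  (forall n m x, moved (f n) x -> moved (f m) x -> f n x = f m x) ->
  exists F : mpbij mu, [/\ in_group F, involutive F & pasted f F].
Proof.
move=> fG fI ff.
have symE n x : mpbij_sym (f n) x = f n x by rewrite -{1}[x](fI n) symK.
have [n m x fn fm|F FG [Ff Fid]] := glue_moved fG ff.
  by rewrite !symE; exact: ff.
exists F; split=> // x.
have [fx|/existsNP[n fn]] := pselect (forall n, f n x = x).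
  by rewrite !Fid.
by rewrite (Ff n)// (Ff n) ?fI//; exact: moved_stable.
Qed.

(** The involution that an element f displacing P induces on P and f(P). *)
Lemma exchange (f : mpbij mu) (P : set T) : in_group f -> measurable P ->
  (forall x, P x -> ~ P (f x)) ->
  exists s : mpbij mu, [/\ in_group s, involutive s,
    forall x, P x -> s x = f x, forall x, P x -> s (f x) = x &
    forall x, ~ P x -> ~ P (mpbij_sym f x) -> s x = x].
Proof.
move=> fG mP Pf.
have /choice[t tP] : forall x, exists y, [/\ P x -> y = f x,
    P (mpbij_sym f x) -> y = mpbij_sym f x &
    ~ P x -> ~ P (mpbij_sym f x) -> y = x].
  move=> x; have [Px|nPx] := pselect (P x).
    exists (f x); split=> // /Pf; by rewrite symKV.
  have [Pfx|nPfx] := pselect (P (mpbij_sym f x)).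
    by exists (mpbij_sym f x).
  by exists x.
have tf x : P x -> t x = f x by case: (tP x).
have tfV x : P x -> t (f x) = x.
  by move=> Px; have [_ + _] := tP (f x); rewrite symK => ->.
have tid x : ~ P x -> ~ P (mpbij_sym f x) -> t x = x by case: (tP x).
have tI : involutive t.
  move=> x; have [Px|nPx] := pselect (P x); first by rewrite (tf x Px) tfV.
  have [Pfx|nPfx] := pselect (P (mpbij_sym f x)); last by rewrite !tid.
  have := tf _ Pfx; rewrite symKV => tE.
  by have := tfV _ Pfx; rewrite symKV => ->.
have [|s sG sE] := glue tI tI.
  pose Q := mpbij_sym f @^-1` P.
  have mQ : measurable Q by exact: measurable_bij.
  have -> : setT = (P `|` Q) `|` ~` (P `|` Q) by rewrite setUv.
  apply: locally_inU; first apply: locally_inU.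
  - exact: (locally_in1 mP fG).
  - apply: (locally_in1 mQ (in_group_sym fG)) => x Qx.
    by have [_ ->] := tP x.
  - apply: (@locally_in1 _ (mpbij_id mu)).
    + by apply: measurableC; exact: measurableU.
    + exact: in_group_id.
    + by move=> x /not_orP[]; exact: tid.
by exists s; split=> [//|x|x|x|x]; rewrite !sE; auto.
Qed.

Lemma restrict_stable (f : mpbij mu) (P : set T) : in_group f -> measurable P ->
  (forall x, P (f x) <-> P x) ->
  exists2 g : mpbij mu, in_group g &
    (forall x, P x -> g x = f x) /\ (forall x, ~ P x -> g x = x).
Proof.
move=> fG mP Pf.
have PfV x : P (mpbij_sym f x) <-> P x by rewrite -Pf symKV.
pose t (h : T -> T) x := if pselect (P x) then h x else x.
have tK (h k : T -> T) : (forall x, P (h x) <-> P x) -> cancel h k ->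
    cancel (t h) (t k).
  move=> Ph hK x; rewrite {2}/t; case: (pselect (P x)) => Px.
    by rewrite /t; case: (pselect (P (h x))) => [Phx|/Ph//]; rewrite hK.
  by rewrite /t; case: (pselect (P x)).
have [|g gG gE] := glue (tK _ _ Pf (symK f)) (tK _ _ PfV (symKV f)).
  rewrite -(setUv P); apply: locally_inU.
    by apply: (locally_in1 mP fG) => x Px; rewrite /t; case: pselect.
  apply: (@locally_in1 _ (mpbij_id mu)); first exact: measurableC.
    exact: in_group_id.
  by move=> x Px; rewrite /t; case: pselect.
by exists g => //; split=> x Px; rewrite gE /t; case: pselect.
Qed.

End FullGroup.

(** * Displaced sets and sets of prescribed mass *)
Section Displacement.
Context (R : realType) d (T : standardBorelType R d) (mu : probability T R).

Lemma separating_sequence : exists2 U : nat -> set T,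
  forall n, measurable (U n) & forall x y, x <> y -> exists n, U n x /\ ~ U n y.
Proof.
have [M [[D cD dD] _ mE]] := @standard_borelP R d T.
set P : metricType R := Metric.Pack M in D cD dD mE.
have mball (a : P) e : measurable (ball a e : set T).
  rewrite mE; apply: sub_sigma_algebra; rewrite openE => x.
  rewrite ballEmdist /= => ax; apply/nbhs_ballP; exists (e - mdist a x) => /=.
    by rewrite subr_gt0.
  move=> y; rewrite !ballEmdist /= ltrBrDl => xy.
  exact: le_lt_trans (metric_triangle _ _ _) xy.
have [D0|[a]] := pfcard_geP cD.
  exists (fun=> set0) => [n|x]; first exact: measurable0.
  have [||y []] := dD setT; [by exists x|exact: openT|by rewrite D0].
exists (fun k => if (unpickle k : option (nat * nat)) is Some (i, n) then
    (ball (a i : P) n.+1%:R^-1 : set T) else set0) => [k|x y xy].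
  by case: unpickle => [[i n]|]; [exact: mball|exact: measurable0].
have e0 : 0 < mdist (x : P) (y : P) / 2.
  by rewrite divr_gt0// mdist_gt0; apply/eqP.
have [n _ nP] := near_infty_natSinv_lt (PosNum e0).
have {nP} /= n2 := nP n (leqnn n).
have [||z [/= xz Dz]] := dD (interior (ball (x : P) n.+1%:R^-1)).
- exists x; exact: nbhsx_ballx.
- exact: open_interior.
have [i _ aE] := @surj _ _ _ _ a z Dz; subst z.
move/interior_subset: xz => xz.
exists (pickle (i, n)); rewrite pickleK; split.
  exact: ball_sym.
rewrite ballEmdist /= => ya; move: xz; rewrite ballEmdist /= => xa.
have := metric_triangle (x : P) (a i) y; clear - n2 xa ya.
by move: (mdist _ _) (mdist _ _) (mdist _ _) _^-1 n2 xa ya => *; lra.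
Qed.

(** A maximal set that f moves off itself, built greedily along a sequence U of
    sets separating points: the points of U n sent outside U n are added at
    stage n, except those whose image or preimage has been taken already.
    Maximality is the last clause. *)
Lemma displaced_set (f : mpbij mu) : exists A, [/\ measurable A,
  forall x, A x -> ~ A (f x) &
  forall x, moved f x -> [\/ A x, A (f x) | A (mpbij_sym f x)]].
Proof.
have [U mU sepU] := separating_sequence.
pose P n := U n `\` f @^-1` U n.
pose A := fix A n := if n is k.+1 then
  A k `|` (P k `\` (f @^-1` A k `|` mpbij_sym f @^-1` A k)) else set0.
have mA n : measurable (A n).
  elim: n => [|n mA] /=; first exact: measurable0.
  apply: measurableU => //; apply: measurableD.
    by apply: measurableD; [exact: mU|exact: measurable_bij].
  apply: measurableU; first exact: measurable_bij.
  exact: (measurable_bij (mpbij_sym f)).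
have A_le n m x : (n <= m)%N -> A n x -> A m x.
  move=> /subnK <-; elim: (m - n)%N => // k IH Ax.
  by left; exact: IH.
have Af n x : A n x -> ~ A n (f x).
  elim: n => [//|n IH] /= [Ax|[[Ux nUfx] /not_orP[nAfx _]]].
    case=> [|[_ /not_orP[_]]]; first exact: IH.
    by rewrite /preimage /= mpbijK.
  by case=> [/nAfx//|[[]]].
exists (\bigcup_n A n); split=> [||x fx].
- exact: bigcupT_measurable.
- move=> x [n _ Ax] [m _ Afx]; apply: (Af (maxn n m) x).
    exact: A_le (leq_maxl _ _) Ax.
  exact: A_le (leq_maxr _ _) Afx.
have [|n [Ux nUfx]] := sepU x (f x); first by move=> xE; exact: fx.
have [Afx|nAfx] := pselect (A n (f x)); first by constructor 2; exists n.
have [Afx|nAfVx] := pselect (A n (mpbij_sym f x)).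
  by constructor 3; exists n.
constructor 1; exists n.+1 => //=; right; split=> //.
by move=> [].
Qed.

Lemma displaced_moved (f : mpbij mu) A :
  (forall x, A x -> ~ A (f x)) -> A `<=` moved f.
Proof. by move=> Af x Ax fx; apply: (Af _ Ax); rewrite fx. Qed.

Lemma mass_displaced (f : mpbij mu) A : measurable A ->
  (forall x, moved f x -> [\/ A x, A (f x) | A (mpbij_sym f x)]) ->
  mass mu (moved f) <= 3 * mass mu A.
Proof.
move=> mA Af; have mfA := measurable_bij f mA.
have mfVA := measurable_bij (mpbij_sym f) mA.
have mU := measurableU _ _ mA mfA.
have le1 := mass_leU mu mA mfA; have le2 := mass_leU mu mU mfVA.
have : mass mu (moved f) <=
    mass mu (A `|` f @^-1` A `|` mpbij_sym f @^-1` A).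
  apply: le_mass; [exact: measurable_moved|exact: measurableU|].
  by move=> x /Af[]; [left; left|left; right|right].
rewrite !mass_preimage// in le1 le2; lra.
Qed.

(** For an involution the two translates of a maximal displaced set coincide,
    so that such a set is a fundamental domain. *)
Lemma involution_domain (t : mpbij mu) : involutive t ->
  exists C, [/\ measurable C, forall x, C x -> ~ C (t x) &
    forall x, moved t x -> C x \/ C (t x)].
Proof.
move=> tI; have [C [mC Ct CU]] := displaced_set t; exists C; split=> // x.
have tV : mpbij_sym t x = t x by rewrite -{1}[x]tI symK.
by move=> /CU[]; rewrite ?tV; [left|right|right].
Qed.

Context (mu_atomless : atomless mu).

Lemma small_subset A e : measurable A -> 0 < mass mu A -> 0 < e ->
  exists B, [/\ measurable B, B `<=` A & 0 < mass mu B < e].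
Proof.
move=> mA A0 e0.
have halves n : exists B, [/\ measurable B, B `<=` A, 0 < mass mu B &
    mass mu B * 2 ^+ n <= 1].
  elim: n => [|n [B [mB BA B0 Bn]]].
    exists A; split=> //; rewrite expr0 mulr1 -(mass_setT mu).
    exact: le_mass.
  have [|C [mC CB]] := mu_atomless mB; first by rewrite massE// lte_fin.
  rewrite !massE// !lte_fin => C0 CltB.
  have BC := massD mu mB mC CB.
  have [le|lt] := leP (2 * mass mu C) (mass mu B).
    exists C; split=> //; first exact: subset_trans BA.
    apply: le_trans Bn; rewrite exprS mulrA [_ * 2]mulrC.
    by rewrite ler_wpM2r// exprn_ge0.
  exists (B `\` C); split; [exact: measurableD|by move=> x [/BA]|lra|].
  apply: le_trans Bn; rewrite exprS mulrA [_ * 2]mulrC.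
  by rewrite ler_wpM2r// ?exprn_ge0//; lra.
have [n _ nP] := near_infty_natSinv_lt (PosNum e0).
have {nP} /= ne := nP n (leqnn n).
have [B [mB BA B0 Bn]] := halves n; exists B; split=> //.
rewrite B0 /=; apply: le_lt_trans ne.
rewrite -[leRHS]mul1r ler_pdivlMr ?ltr0n//; apply: le_trans Bn.
rewrite ler_wpM2l ?(ltW B0)// -natrX ler_nat.
exact: ltn_expl.
Qed.

(** Sierpinski's theorem: a subset that is maximal among those of mass at most
    c has mass c, since otherwise a small set could be added to it. *)
Lemma subset_of_mass A c : measurable A -> 0 <= c <= mass mu A ->
  exists B, [/\ measurable B, B `<=` A & mass mu B = c].
Proof.
move=> mA /andP[c0 cA].
pose P (B : set T) := [/\ measurable B, B `<=` A & mass mu B <= c].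
pose S := {B : set T | P B}.
pose le (B C : S) := sval B `<=` sval C.
have P0 : P set0 by split=> //; rewrite mass_set0.
have [|||B|u uS|B' _ Bmax] :=
  @maximal_value R S le (fun B => mass mu (sval B)) c _ _ _ _ _
    (exist P _ P0).
- by move=> B.
- by move=> x y z; exact: subset_trans.
- by move=> x y xy; apply: le_mass => //; [case: (svalP x)|case: (svalP y)].
- by case: (svalP B).
- have uP n : [/\ measurable (sval (u n)), sval (u n) `<=` A &
    mass mu (sval (u n)) <= c] := svalP (u n).
  have VP : [/\ measurable (\bigcup_n sval (u n)),
      \bigcup_n sval (u n) `<=` A & mass mu (\bigcup_n sval (u n)) <= c].
    split; first by apply: bigcupT_measurable => n; have [] := uP n.
      by move=> x [n _]; have [_ + _] := uP n; exact.
    apply: mass_bigcup_le => n; [by have [] := uP n|exact: uS|].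
    by have [] := uP n.
  by exists (exist P _ VP) => n x ux; exists n.
have [mB BA Bc] := svalP B'; set B := sval B' in mB BA Bc.
exists B; split=> //; apply/eqP; rewrite eq_le Bc leNgt; apply/negP => ltBc.
have mAB : measurable (A `\` B) by exact: measurableD.
have ABE := massD mu mA mB BA.
have [||C [mC CAB /andP[C0 CcB]]] :=
  @small_subset (A `\` B) (c - mass mu B) mAB.
- rewrite ABE; lra.
- lra.
have BCE : mass mu (B `|` C) = mass mu B + mass mu C.
  by apply: massU => // x Bx /CAB[].
have BCP : [/\ measurable (B `|` C), B `|` C `<=` A & mass mu (B `|` C) <= c].
  split; [exact: measurableU|by move=> x [/BA|/CAB[]]|rewrite BCE; lra].
have := Bmax (exist P _ BCP) (fun x => @or_introl _ _).
by rewrite /= BCE -/B; lra.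
Qed.

End Displacement.

(** * Transport between sets of equal mass *)
Section Transport.
Context (R : realType) d (T : standardBorelType R d) (mu : probability T R).
Context (G : groupClosed (Aut mu)).
Context (G_full : full_group G) (G_ergodic : ergodic G).

Local Notation mass := (mass mu).
Local Notation in_group := (in_group G).

(** If this failed, consider the sets all of whose translates meet B in a null
    set.  They form a class containing A and closed under countable unions and
    under translation, so that a member of the class which is maximal in mass
    is invariant, hence conull by ergodicity: B would be null. *)
Lemma ergodic_meets A B : measurable A -> measurable B ->
  0 < mass A -> 0 < mass B ->
  exists2 f : mpbij mu, in_group f & 0 < mass (A `&` f @^-1` B).
Proof.
move=> mA mB A0 B0; apply: contrapT => noG.
pose P (C : set T) := measurable C /\
  forall f : mpbij mu, in_group f -> mass (C `&` f @^-1` B) = 0.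
pose S := {C : set T | P C}.
pose le (C D : S) := sval C `<=` sval D.
have AP : measurable A /\
    forall f : mpbij mu, in_group f -> mass (A `&` f @^-1` B) = 0.
  split=> // f fG; apply/eqP; rewrite eq_le mass_ge0 andbT leNgt.
  by apply/negP => f0; apply: noG; exists f.
have mC1 (C : S) : measurable (sval C) by case: (svalP C).
have [|||C|u uS|C' AC Cmax] :=
  @maximal_value R S le (fun C => mass (sval C)) 1 _ _ _ _ _ (exist P A AP).
- by move=> C.
- by move=> x y z; exact: subset_trans.
- by move=> C D CD; exact: le_mass.
- by rewrite -(mass_setT mu) le_mass.
- have VP : measurable (\bigcup_n sval (u n)) /\ forall f : mpbij mu,
      in_group f -> mass ((\bigcup_n sval (u n)) `&` f @^-1` B) = 0.
    split=> [|f fG]; first exact: bigcupT_measurable.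
    rewrite setI_bigcupl; apply: mass_bigcup0 => n.
      by apply: measurableI => //; exact: measurable_bij.
    by have [_] := svalP (u n); exact.
  by exists (exist P _ VP) => n x ux; exists n.
have [mC CB] := svalP C'; set C := sval C' in mC CB.
have Cinv : invariant_set G C.
  move=> f fG; have imE : f @` C = mpbij_sym f @^-1` C.
    apply/seteqP; split=> [_ [x Cx <-]|x Cx].
      by rewrite /preimage /= mpbijK.
    by exists (mpbij_sym f x) => //; exact: symKV.
  set D := mpbij_sym f @^-1` C in imE.
  have mD : measurable D by exact: measurable_bij.
  have mCD : measurable (C `|` D) by exact: measurableU.
  have CDP : measurable (C `|` D) /\ forall g : mpbij mu, in_group g ->
      mass ((C `|` D) `&` g @^-1` B) = 0.
    split=> // g gG; apply/eqP; rewrite eq_le mass_ge0 andbT setIUl.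
    have mgB : measurable (g @^-1` B) by exact: measurable_bij.
    have := mass_leU mu (measurableI _ _ mC mgB) (measurableI _ _ mD mgB).
    rewrite CB// add0r.
    have -> : D `&` g @^-1` B =
        mpbij_sym f @^-1` (C `&` (mpbij_comp g f) @^-1` B).
      by apply/seteqP; split=> x [] Dx /=; rewrite /preimage /= ?mpbij_invK.
    rewrite mass_preimage ?CB//; first exact: in_group_comp.
    by apply: measurableI => //; exact: measurable_bij.
  have CDE : mass (C `|` D) = mass C.
    have CDle : mass (C `|` D) <= mass C.
      by apply: (Cmax (exist P _ CDP)) => x; left.
    by apply/eqP; rewrite eq_le CDle le_mass// => x; left.
  have DC : mass D = mass C by exact: mass_preimage.
  have Y0 (E : set T) : measurable E -> E `<=` C `|` D -> mass E = mass C ->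
      mu ((C `|` D) `\` E) = 0%E.
    move=> mE ECD EC; rewrite massE; last exact: measurableD.
    by rewrite massD// CDE EC subrr.
  have NC := Y0 C mC (fun x => @or_introl _ _) erefl.
  have ND := Y0 D mD (fun x => @or_intror _ _) DC.
  rewrite imE (_ : D `+` C = ((C `|` D) `\` C) `|` ((C `|` D) `\` D)).
    apply/negligibleP; first by apply: measurableU; exact: measurableD.
    by apply: negligibleU; apply/negligibleP => //; exact: measurableD.
  by apply/seteqP; split=> x /=; rewrite /setY; tauto.
have mnC := measurableC mC.
have [C0|nC0] := G_ergodic mC Cinv.
  have := le_mass mu mA mC AC; move: A0; rewrite /mass C0 /=; lra.
have : mass B <= mass (C `&` B `|` ~` C).
  apply: le_mass => // [|x Bx].
    by apply: measurableU => //; exact: measurableI.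
  by have [Cx|] := pselect (C x); [left|right].
have := mass_leU mu (measurableI _ _ mC mB) mnC.
have := CB _ (in_group_id G); rewrite (_ : _ @^-1` B = B)// => ->.
have -> : mass (~` C) = 0 by rewrite /mass nC0.
lra.
Qed.

(** An involution exchanging part of A with part of B and moving nothing else
    is taken maximal.  If it left points of A of positive mass unmoved, it would
    also leave points of B unmoved, and by ergodicity some element of the group
    would send a nonnull set of the former into the latter, which gives
    a larger involution. *)
Lemma transport A B : measurable A -> measurable B -> A `<=` ~` B ->
  mass A <= mass B ->
  exists r : mpbij mu, [/\ in_group r, involutive r,
    forall x, moved r x -> A x /\ B (r x) \/ B x /\ A (r x) &
    mass (A `\` moved r) = 0].
Proof.
move=> mA mB AB leAB.
pose P (r : mpbij mu) := [/\ in_group r, involutive r &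
  forall x, moved r x -> A x /\ B (r x) \/ B x /\ A (r x)].
pose S := {r : mpbij mu | P r}.
pose le (r s : S) := forall x, moved (sval r) x -> sval s x = sval r x.
have P1 : P (mpbij_id mu) by split=> //; exact: in_group_id.
have mm := @measurable_moved R d T mu.
have le_moved (r s : S) : le r s -> moved (sval r) `<=` moved (sval s).
  by move=> rs x rx; rewrite /moved /= rs.
have [||||u uS|r' _ rmax] :=
  @maximal_value R S le (fun r => mass (moved (sval r))) 1 _ _ _ _ _
    (exist P _ P1).
- by move=> r.
- move=> r s t rs st x rx; rewrite st ?rs//; exact: le_moved rs _ rx.
- by move=> r s rs; apply: le_mass => //; exact: le_moved.
- by move=> r; rewrite -(mass_setT mu) le_mass.
- have uP n : P (sval (u n)) := svalP (u n).
  have u_le n m : (n <= m)%N -> le (u n) (u m).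
    move=> /subnK <-; elim: (m - n)%N => [//|k IH] x ux.
    by rewrite addSn uS ?IH//; exact: le_moved IH _ ux.
  have [|||F [FG FI [Fu Fid]]] :=
    @glue_invol _ _ _ _ _ G_full (fun n => sval (u n)).
  + by move=> n; have [] := uP n.
  + by move=> n; have [] := uP n.
  + move=> n m x un um; have [nm|/ltnW mn] := leqP n m.
      by rewrite (u_le _ _ nm).
    by rewrite (u_le _ _ mn).
  have FP : P F.
    split=> // x Fx.
    have [n un] : exists n, moved (sval (u n)) x.
      apply: contrapT => nu; apply: Fx; apply: Fid => n.
      by apply: contrapT => un; apply: nu; exists n.
    by rewrite (Fu n)//; have [_ _] := uP n; exact.
  by exists (exist P _ FP) => n x; exact: Fu.
have [rG rI rAB] := svalP r'; set r := sval r' in rG rI rAB.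
exists r; split=> //; apply/eqP; rewrite eq_le mass_ge0 andbT leNgt.
apply/negP => A0; set A' := A `\` moved r in A0.
pose B' := B `\` moved r.
have mA' : measurable A' by exact: measurableD.
have mB' : measurable B' by exact: measurableD.
have mr : measurable (moved r) by [].
have swapE : A `&` moved r = r @^-1` (B `&` moved r).
  apply/seteqP; split=> x [Ax rx].
    split; last exact: moved_stable.
    by have [[]//|[/(AB _ Ax)]] := rAB x rx.
  have rx' : moved r x by move/moved_stable: rx; rewrite rI.
  by have [[]|[Bx /AB]] := rAB x rx'.
have B0 : 0 < mass B'.
  have AI := massID mu mA mr; have BI := massID mu mB mr.
  rewrite swapE mass_preimage in AI; last exact: measurableI.
  by rewrite /A' /B' in A0 *; lra.
have [f fG fAB] := ergodic_meets mA' mB' A0 B0.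
set P0 := A' `&` f @^-1` B' in fAB.
have mP0 : measurable P0 by apply: measurableI => //; exact: measurable_bij.
have P0f x : P0 x -> ~ P0 (f x).
  by move=> [_ [Bfx _]] [[/AB]].
have [s [sG sI sP sfP sid]] := exchange G_full fG mP0 P0f.
have s_moved x : moved s x -> A' x /\ B' (s x) \/ B' x /\ A' (s x).
  move=> sx; have [Px|nPx] := pselect (P0 x).
    by left; rewrite sP//; case: Px.
  have [Px|nPfx] := pselect (P0 (mpbij_sym f x)); last by case: sx; exact: sid.
  right; have := sfP _ Px; rewrite symKV => ->.
  by case: Px => ?; rewrite /preimage /= mpbij_invK.
have disj x : moved r x -> moved s x -> False.
  by move=> rx /s_moved[[[_]]|[[_]]].
have [|||F [FG FI [Frs Fid]]] :=
  @glue_invol _ _ _ _ _ G_full (fun n => if n is 0%N then r else s).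
- by case.
- by case.
- by move=> [|n] [|m] x // ? ?; exfalso; apply: (disj x).
have Fr := Frs 0%N; have {Frs} Fs := Frs 1%N; rewrite /= in Fr Fs.
have FP : P F.
  split=> // x Fx; have [rx|] := pselect (moved r x).
    by rewrite Fr//; exact: rAB.
  move=> /contrapT rx; have [sx|/contrapT sx] := pselect (moved s x).
    rewrite Fs//.
    by have [[[? _] [? _]]|[[? _] [? _]]] := s_moved x sx; [left|right].
  by case: Fx; apply: Fid; case.
have := rmax (exist P _ FP) Fr; rewrite /= leNgt => /negP; apply.
have P0s : P0 `<=` moved s.
  move=> x Px; rewrite /moved /= sP// => fx; case: Px => -[Ax _] [].
  by rewrite /= fx => /(AB _ Ax).
have : mass (moved r `|` P0) <= mass (moved F).
  apply: le_mass => //; first exact: measurableU.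
  move=> x [rx|/P0s sx]; first by rewrite /moved /= Fr.
  by rewrite /moved /= Fs.
rewrite massU//; last by move=> x rx /P0s; exact: disj.
lra.
Qed.

End Transport.

(** * Conjugacy of involutions and commutators *)
Section Conjugacy.
Context (R : realType) d (T : standardBorelType R d) (mu : probability T R).

Lemma aut_class_comp (f g : mpbij mu) :
  aut_class (mpbij_comp f g) = (aut_class f * aut_class g)%g.
Proof. by rewrite -aut_mulE. Qed.

Lemma aut_class_sym (f : mpbij mu) :
  aut_class (mpbij_sym f) = ((aut_class f)^-1)%g.
Proof. by rewrite -aut_invE. Qed.

Lemma aut_class_null (f g : mpbij mu) N : measurable N -> mass mu N = 0 ->
  (forall x, ~ N x -> f x = g x) -> aut_class f = aut_class g.
Proof.
move=> mN N0 fg; apply/aut_classP; exists N; split=> //.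
  by rewrite massE// N0.
by move=> x; apply: contra_notP => /fg.
Qed.

Lemma aut_class_ext (f g : mpbij mu) : f =1 g -> aut_class f = aut_class g.
Proof. by move=> fg; apply/aut_classP/aeW. Qed.

Lemma sym_invol (t : mpbij mu) : involutive t -> mpbij_sym t =1 t.
Proof. by move=> tI x; rewrite -{1}[x]tI symK. Qed.

Context (G : groupClosed (Aut mu)).
Context (G_full : full_group G) (G_ergodic : ergodic G).

Local Notation mass := (mass mu).
Local Notation in_group := (in_group G).

(** If s exchanges the fundamental domains C and C', then s on C and t' s t on
    t(C) together form an involution k that intertwines t and t'. *)
Lemma conjugate_involutions (t t' : mpbij mu) C C' :
  in_group t -> involutive t -> in_group t' -> involutive t' ->
  measurable C -> (forall x, C x -> ~ C (t x)) ->
  (forall x, moved t x -> C x \/ C (t x)) ->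
  measurable C' -> (forall x, C' x -> ~ C' (t' x)) ->
  (forall x, moved t' x -> C' x \/ C' (t' x)) ->
  moved t `<=` ~` moved t' -> mass C = mass C' ->
  exists2 k : mpbij mu, in_group k &
    aut_class t' = (aut_class k * aut_class t * (aut_class k)^-1)%g.
Proof.
move=> tG tI t'G t'I mC Ct CU mC' C't' C'U tt' CC'.
have C_moved := displaced_moved Ct; have C'_moved := displaced_moved C't'.
have t_moved x : moved t x -> moved t (t x) by exact: moved_stable.
have t'_moved x : moved t' x -> moved t' (t' x) by exact: moved_stable.
have t_movedV x : moved t (t x) -> moved t x by move/t_moved; rewrite tI.
have t'_movedV x : moved t' (t' x) -> moved t' x by move/t'_moved; rewrite t'I.
have CnC' : C `<=` ~` C' by move=> x /C_moved /tt' nx /C'_moved.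
have [|s [sG sI sCC' sC]] := transport G_full G_ergodic mC mC' CnC'.
  by rewrite CC'.
have ms := @measurable_moved R d T mu s.
pose C0 := C `&` moved s; pose D0 := C' `&` moved s.
have s_moved x : moved s x -> moved s (s x) by exact: moved_stable.
have sC0 x : C0 x -> D0 (s x).
  move=> [Cx sx]; split; last exact: s_moved.
  by have [[]|[/(CnC' _ Cx)]] := sCC' x sx.
have sD0 x : D0 x -> C0 (s x).
  move=> [Cx sx]; split; last exact: s_moved.
  by have [[/CnC']|[]] := sCC' x sx.
have sC' : mass (C' `\` moved s) = 0.
  have CE := massID mu mC ms; have C'E := massID mu mC' ms.
  have CD : C0 = s @^-1` D0.
    by apply/seteqP; split=> x; [exact: sC0|move/sD0; rewrite sI].
  have : mass C0 = mass D0.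
    by rewrite CD mass_preimage//; exact: measurableI.
  by rewrite -/C0 -/D0 in CE C'E; lra.
pose f := mpbij_comp t' (mpbij_comp s t).
have fG : in_group f by do 2?apply: in_group_comp.
have fVE x : mpbij_sym f x = t (s (t' x)).
  by rewrite -[x in LHS](_ : f (t (s (t' x))) = x) ?symK// /= tI sI t'I.
have mP : measurable (t @^-1` C0).
  by apply: measurable_bij; exact: measurableI.
have [|u [uG uI uP ufP uid]] := exchange G_full fG mP.
  move=> x /sC0 [/C'_moved /t'_moved fx _] [/C_moved /t_movedV].
  by move/tt'; exact.
have u_moved x : moved u x -> C0 (t x) \/ D0 (t' x).
  move=> ux; have [Px|nPx] := pselect (C0 (t x)); first by left.
  have [Px|nPfx] := pselect (C0 (t (mpbij_sym f x))); last first.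
    by case: ux; exact: uid.
  by right; move: Px; rewrite fVE tI => /sC0; rewrite sI.
have su x : moved s x -> moved u x -> False.
  move=> sx /u_moved; have [[Cx _]|[C'x _]] := sCC' x sx => -[[Cy _]|[C'y _]].
  - exact: Ct Cx Cy.
  - by move/C'_moved/t'_movedV: C'y; apply/tt'/C_moved.
  - by move/C_moved/t_movedV: Cy => /tt'; apply; exact: C'_moved.
  - exact: C't' C'x C'y.
have [|||k [kG kI [ksu kid]]] :=
  @glue_invol _ _ _ _ _ G_full
    (fun n => if n is 0%N then s else u).
- by case.
- by case.
- by move=> [|n] [|m] x // ? ?; exfalso; apply: (su x).
have ks x : moved s x -> k x = s x by exact: (ksu 0%N).
have ku x : C0 (t x) -> k x = t' (s (t x)).
  move=> Cx; rewrite -[RHS](uP x)//; apply: (ksu 1%N); rewrite /moved /= uP//.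
  move=> xE; have [/C'_moved/t'_moved] := sC0 _ Cx.
  by rewrite [t' _]xE => /tt'; case: Cx => /C_moved/t_movedV.
have kv x : D0 (t' x) -> k x = t (s (t' x)).
  move=> /sD0 Cx; have := ku (t (s (t' x))); rewrite tI => /(_ Cx).
  by rewrite sI t'I => {1}<-; rewrite kI.
exists k => //.
rewrite -aut_class_sym -!aut_class_comp.
pose N := (C `\` moved s) `|` t @^-1` (C `\` moved s) `|`
  ((C' `\` moved s) `|` t' @^-1` (C' `\` moved s)).
have mCs : measurable (C `\` moved s) by exact: measurableD.
have mC's : measurable (C' `\` moved s) by exact: measurableD.
have mtCs := measurable_bij t mCs; have mt'C's := measurable_bij t' mC's.
have mU1 := measurableU _ _ mCs mtCs; have mU2 := measurableU _ _ mC's mt'C's.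
apply: (@aut_class_null _ _ N); first exact: measurableU.
  have := mass_leU mu mU1 mU2; have := mass_leU mu mCs mtCs.
  have := mass_leU mu mC's mt'C's; rewrite !mass_preimage// sC sC'.
  by have := mass_ge0 mu N; rewrite -/N; lra.
move=> x /not_orP[/not_orP[nC ntC] /not_orP[nC' nt'C']].
have inC0 y : ~ (C `\` moved s) y -> C y -> C0 y.
  by move=> ny Cy; split=> //; apply: contrapT => sy; exact: ny.
have inD0 y : ~ (C' `\` moved s) y -> C' y -> D0 y.
  by move=> ny Cy; split=> //; apply: contrapT => sy; exact: ny.
rewrite /= -[mpbij_inv k]/(mpbij_sym k : T -> T) sym_invol//.
have [tx|/contrapT tx] := pselect (moved t x).
  have -> : t' x = x by apply: contrapT; exact: tt'.
  suff kx : moved t' (k x).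
    have -> : t (k x) = k x by apply: contrapT => /tt'.
    by rewrite kI.
  have [/(inC0 _ nC)Cx|/(inC0 _ ntC)Cx] := CU x tx.
    by rewrite ks; [have [/C'_moved] := sC0 _ Cx|case: Cx].
  by rewrite ku//; apply: t'_moved; have [/C'_moved] := sC0 _ Cx.
have [t'x|/contrapT t'x] := pselect (moved t' x).
  have [/(inD0 _ nC')Cx|/(inD0 _ nt'C')Cx] := C'U x t'x.
    rewrite (ks x); last by case: Cx.
    by rewrite ku tI ?sI//; exact: sD0.
  by rewrite (kv x)// tI ks ?sI//; have [] := sD0 _ Cx.
have kx : k x = x.
  apply: kid => -[|_]; apply: contrapT.
    by move/sCC' => [[/C_moved]|[/C'_moved]].
  by move/u_moved => [[/C_moved/t_movedV]|[/C'_moved/t'_movedV]].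
by rewrite kx tx t'x kx.
Qed.

(** On a set A that g displaces, take an involution h exchanging two disjoint
    subsets A1 and A2 up to null sets.  Since h and its conjugate by g have
    disjoint supports, the commutator of h and g is an involution whose
    fundamental domain is the union of A1 and g(A1).  Its mass is adjusted to
    that of a fundamental domain of t, and A is cut down away from t so that
    the two involutions are conjugate.  The constant 16 leaves room for this: A
    has mass at least a / 3, and avoiding the points moved by t costs at most
    a / 8. *)
Lemma commutator_involution (mu_atomless : atomless mu) (g t : mpbij mu) a :
  in_group g -> in_group t -> involutive t ->
  a <= mass (moved g) -> 16 * mass (moved t) <= a ->
  exists h k : mpbij mu, [/\ in_group h, in_group k &
    aut_class t = (aut_class k * (aut_class h * aut_class g *
      (aut_class h)^-1 * (aut_class g)^-1) * (aut_class k)^-1)%g].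
Proof.
move=> gG tG tI ag ta.
have mt := @measurable_moved R d T mu t.
have [A [mA Ag AU]] := displaced_set g.
have gA := mass_displaced mA AU.
have [C [mC Ct CU]] := involution_domain tI.
have Ct_le : mass C <= mass (moved t).
  by apply: le_mass => //; exact: displaced_moved.
pose E := moved t `|` g @^-1` moved t.
have mgt := measurable_bij g mt.
have mE : measurable E by exact: measurableU.
pose A' := A `\` E.
have mA' : measurable A' by exact: measurableD.
have A'_ge : mass C <= mass A'.
  have := massID mu mA mE; have := mass_leU mu mt mgt; rewrite mass_preimage//.
  have : mass (A `&` E) <= mass E.
    by apply: le_mass; [exact: measurableI| |move=> x []].
  by rewrite -/A' -/E; have := mass_ge0 mu C; lra.
have C_ge0 := mass_ge0 mu C.
have [|A1 [mA1 A1A' A1E]] :=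
    @subset_of_mass _ _ _ _ mu_atomless A' (mass C / 2) mA'.
  by lra.
have A'1E := massD mu mA' mA1 A1A'.
have [||A2 [mA2 A2A' A2E]] :=
    @subset_of_mass _ _ _ _ mu_atomless (A' `\` A1) (mass C / 2).
- exact: measurableD.
- by lra.
have A12 : A1 `<=` ~` A2 by move=> x A1x /A2A'[].
have [|h [hG hI hA hA1]] := transport G_full G_ergodic mA1 mA2 A12.
  by rewrite A1E A2E.
have hA' x : moved h x -> A' x.
  by move=> /hA[[/A1A']|[/A2A'[]]].
pose hg := mpbij_comp g (mpbij_comp h (mpbij_sym g)).
have hgE x : hg x = g (h (mpbij_sym g x)) by [].
have hg_moved x : moved hg x -> moved h (mpbij_sym g x).
  by move=> gx hx; apply: gx; rewrite hgE hx symKV.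
have hgI : involutive hg by move=> x; rewrite !hgE symK hI symKV.
have h_hg x : moved h x -> moved hg x -> False.
  move=> /hA'[Ax _] /hg_moved/hA'[Agx _].
  by apply: (Ag _ Agx); rewrite symKV.
pose c := mpbij_comp h hg.
have cE x : c x = h (hg x) by [].
have cG : in_group c.
  by do !apply: in_group_comp => //; exact: in_group_sym.
have ch x : moved h x -> c x = h x.
  by move=> hx; rewrite cE; congr (h _); apply: contrapT => /(h_hg _ hx).

have cg x : moved hg x -> c x = hg x.
  move=> gx; rewrite cE; apply: contrapT => hx.
  exact: h_hg hx (moved_stable gx).
have c_moved x : moved c x -> moved h x \/ moved hg x.
  move=> cx; have [|/contrapT gx] := pselect (moved hg x); [by right|left].
  by move=> hx; apply: cx; rewrite cE gx.
have cI : involutive c.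
  move=> x; have [cx|/contrapT cx] := pselect (moved c x); last by rewrite !cx.
  have [hx|gx] := c_moved x cx.
    by rewrite (ch x)// ch ?hI//; exact: moved_stable.
  by rewrite (cg x)// cg ?hgI//; exact: moved_stable.
pose B := A1 `&` moved h.
have mB : measurable B by apply: measurableI => //; exact: measurable_moved.
pose C' := B `|` mpbij_sym g @^-1` B.
have mgB := measurable_bij (mpbij_sym g) mB.
have mC' : measurable C' by exact: measurableU.
have BA x : B x -> A x by move=> [/A1A'[]].
have Bh x : B x -> A2 (h x).
  by move=> [A1x hx]; have [[]|[/(A12 _ A1x)]] := hA x hx.
have hgB x : B (mpbij_sym g x) -> moved hg x.
  by move=> [_ hx]; rewrite /moved /mkset hgE => /(canRL (symK g)).
have C'c x : C' x -> ~ C' (c x).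
  move=> [Bx|Bx].
    have hx : moved h x by case: Bx.
    rewrite ch// => -[[/A12 A2hx _]|/BA Ahx]; first exact: A2hx (Bh _ Bx).
    have [Ah _] := hA' _ (moved_stable hx).
    by apply: (Ag _ Ahx); rewrite symKV.
  rewrite cg; last exact: hgB.
  rewrite hgE => -[/BA|]; last rewrite /preimage /= mpbijK.
    by apply: Ag; have [] := A2A' _ (Bh _ Bx); case.
  by move=> -[/A12 A2hx _]; apply: A2hx; exact: (Bh _ Bx).
have C'U x : moved c x -> C' x \/ C' (c x).
  have hB y : moved h y -> B y \/ B (h y).
    move=> hy; have [[A1y _]|[_ A1hy]] := hA y hy; first by left.
    by right; split=> //; exact: moved_stable.
  move=> /c_moved[hx|gx].
    by rewrite ch//; have [Bx|Bx] := hB x hx; [left; left|right; left].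
  rewrite cg//.
  have [Bx|Bx] := hB _ (hg_moved _ gx); [by left; right|right; right].
  by rewrite /preimage /mkset hgE symK.
have CC' : mass C' = mass C.
  rewrite massU//.
    rewrite mass_preimage//.
    have := massID mu mA1 (measurable_moved h); rewrite hA1 -/B A1E; lra.
  by move=> x /BA Ax /BA Agx; apply: (Ag _ Agx); rewrite symKV.
have [||k kG ->] := conjugate_involutions cG cI tG tI mC' C'c C'U mC Ct CU.
- move=> x /c_moved[/hA'[_ nE] tx|/hg_moved/hA'[_ nE] tx]; apply: nE.
    by left.
  by right; rewrite /preimage /mkset symKV.
- exact: CC'.
exists h, k; split=> //; congr (_ * _ * _)%g.
rewrite -aut_class_sym -(aut_class_ext (fun x => esym (sym_invol hI x))).
by rewrite !aut_class_comp aut_class_sym !mulgA.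
Qed.

End Conjugacy.

(** * Splitting off involutions and copying *)
Section Swindle.
Context (R : realType) d (T : standardBorelType R d) (mu : probability T R).

Local Notation mass := (mass mu).

(** Constructions that hold almost everywhere become exact outside a null set
    that is invariant under the countably many maps involved. *)
Lemma saturate_null (f : nat -> mpbij mu) N : measurable N -> mass N = 0 ->
  exists M, [/\ measurable M, mass M = 0, N `<=` M &
    forall i x, M (f i x) <-> M x].
Proof.
move=> mN N0.
pose next (M : set T) :=
  M `|` \bigcup_i (f i @^-1` M `|` mpbij_sym (f i) @^-1` M).
have nullU A B : measurable A -> measurable B -> mass A = 0 ->
    mass B = 0 -> mass (A `|` B) = 0.
  move=> mA mB A0 B0; apply/eqP; rewrite eq_le mass_ge0 andbT.
  by have := mass_leU mu mA mB; rewrite A0 B0 addr0.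
have nextP M : measurable M /\ mass M = 0 ->
    measurable (next M) /\ mass (next M) = 0.
  move=> [mM M0].
  have mf i := measurable_bij (f i) mM.
  have mfV i := measurable_bij (mpbij_sym (f i)) mM.
  have mU : measurable (\bigcup_i (f i @^-1` M `|` mpbij_sym (f i) @^-1` M)).
    by apply: bigcupT_measurable => i; exact: measurableU.
  split; first exact: measurableU.
  apply: (nullU _ _ mM mU) => //.
  apply: mass_bigcup0 => i; first exact: measurableU.
  by apply: (nullU _ _ (mf i) (mfV i)); rewrite mass_preimage.
have MP n : measurable (iter n next N) /\ mass (iter n next N) = 0.
  by elim: n => [//|n]; exact: nextP.
exists (\bigcup_n iter n next N); split.
- by apply: bigcupT_measurable => n; have [] := MP n.
- by apply: mass_bigcup0 => n; have [] := MP n.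
- by move=> x Nx; exists 0%N.
- move=> i x; split=> -[n _ Mx]; exists n.+1 => //; right; exists i => //.
    by left.
  by right; rewrite /preimage /mkset symK.
Qed.

(** The masses decrease at the rate 2 / 3 of [split_involution], so that each
    term of the sequence of [split_sequence] fits into its room. *)
Lemma rooms (mu_atomless : atomless mu) E : measurable E ->
  exists F : nat -> set T, [/\ forall n, measurable (F n),
    forall n, F n `<=` E, trivIset setT F, mass (F 0%N) = mass E / 3 &
    forall n, mass (F n.+1) = 2 / 3 * mass (F n)].
Proof.
move=> mE.
have next (A : {A : set T | measurable A}) : {B : {A : set T | measurable A} |
    sval B `<=` sval A /\ mass (sval B) = 2 / 3 * mass (sval A)}.
  case: A => A mA /=; apply: cid.
  have [|B [mB BA BE]] :=
      @subset_of_mass _ _ _ _ mu_atomless A (2 / 3 * mass A) mA.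
    by have := mass_ge0 mu A; lra.
  by exists (exist _ B mB).
have [u [u0 uS]] := dependent_choice next (exist _ E mE).
pose A n := sval (u n).
have A0 : A 0%N = E by rewrite /A u0.
have mA n : measurable (A n) by rewrite /A; case: (u n).
have AS n : A n.+1 `<=` A n by case: (uS n).
have AE n : mass (A n.+1) = 2 / 3 * mass (A n) by case: (uS n).
have A_le n m : (n <= m)%N -> A m `<=` A n.
  move=> /subnK <-; elim: (m - n)%N => [//|k IH] x.
  by rewrite addSn => /AS/IH.
have FE n : mass (A n `\` A n.+1) = mass (A n) / 3.
  by rewrite (massD mu (mA n) (mA n.+1) (AS n)) AE; lra.
exists (fun n => A n `\` A n.+1); split.
- by move=> n; exact: measurableD.
- by move=> n x [+ _]; rewrite -A0; exact: A_le.
- move=> i j _ _ [x [[Aix nAix] [Ajx nAjx]]].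
  case: (ltngtP i j) => // lt; exfalso.
    by apply: nAix; exact: A_le lt _ Ajx.
  by apply: nAjx; exact: A_le lt _ Aix.
- by rewrite FE A0.
- by move=> n; rewrite !FE AE mulrA.
Qed.

Context (G : groupClosed (Aut mu)).
Context (G_full : full_group G) (G_ergodic : ergodic G).

Local Notation in_group := (in_group G).

Definition involution_in (D : set T) (s : mpbij mu) : Prop :=
  [/\ in_group s, involutive s & moved s `<=` D].

(** On a maximal displaced set A, the involution s undoes g: s g fixes A, which
    has at least one third of the mass of the points moved by g. *)
Lemma split_involution (g : mpbij mu) : in_group g ->
  exists s g' : mpbij mu, [/\ involution_in (moved g) s, in_group g',
    forall x, g x = s (g' x), moved g' `<=` moved g &
    mass (moved g') <= 2 / 3 * mass (moved g)].
Proof.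
move=> gG; have [A [mA Ag AU]] := displaced_set g.
have gA := mass_displaced mA AU; have Amoved := displaced_moved Ag.
have [s [sG sI sA sgA sid]] := exchange G_full gG mA Ag.
have s_moved : moved s `<=` moved g.
  move=> x sx; apply: contrapT => /contrapT gx; apply: sx.
  have nA : ~ A x by move/Amoved.
  by apply: sid => //; rewrite -{1}gx symK.
have g'_moved : moved (mpbij_comp s g) `<=` moved g `\` A.
  move=> x sgx; split=> [gx|Ax]; apply: sgx => /=; last exact: sgA.
  by rewrite gx; apply: contrapT => /s_moved; rewrite /moved /= gx.
exists s, (mpbij_comp s g); split=> //.
- exact: in_group_comp.
- by move=> x /=; rewrite sI.
- by move=> x /g'_moved[].
- have := le_mass mu (measurable_moved _)
    (measurableD (measurable_moved g) mA) g'_moved.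
  by rewrite (massD mu (measurable_moved g) mA Amoved); lra.
Qed.

Lemma split_sequence (g : mpbij mu) : in_group g ->
  exists u s : nat -> mpbij mu, [/\ u 0%N = g, forall n, in_group (u n),
    forall n, involution_in (moved (u n)) (s n),
    forall n x, u n x = s n (u n.+1 x) &
    forall n, moved (u n.+1) `<=` moved (u n) /\
      mass (moved (u n.+1)) <= 2 / 3 * mass (moved (u n))].
Proof.
move=> gG.
pose step (f h : {f : mpbij mu | in_group f}) := exists s : mpbij mu,
  [/\ involution_in (moved (sval f)) s, forall x, sval f x = s (sval h x),
    moved (sval h) `<=` moved (sval f) &
    mass (moved (sval h)) <= 2 / 3 * mass (moved (sval f))].
have next f : {h | step f h}.
  apply: cid; have [s [h [? hG ? ? ?]]] := split_involution (svalP f).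
  by exists (exist _ h hG), s.
have [u [u0 uS]] := dependent_choice next (exist _ g gG).
have [s sP] := choice uS.
exists (fun n => sval (u n)), s; split.
- by rewrite u0.
- by move=> n; exact: svalP.
- by move=> n; have [] := sP n.
- by move=> n; have [] := sP n.
- by move=> n; have [] := sP n.
Qed.

(** The involution by which e exchanges the points moved by a with those moved
    by its copy b conjugates a to b. *)
Lemma exchange_conj (e a b : mpbij mu) : in_group e ->
  (forall x, b (e x) = e (a x)) -> moved a `<=` ~` moved b ->
  exists2 k : mpbij mu, involution_in (moved a `|` moved b) k &
    forall x, k (a (k x)) = b x.
Proof.
move=> eG be ab.
have b_moved x : moved a x <-> moved b (e x).
  rewrite /moved /= be; split=> [ax /(can_inj (symK e))//|bx ax].
  by apply: bx; rewrite ax.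
have [|k [kG kI ka kea kid]] := exchange G_full eG (measurable_moved a).
  by move=> x /b_moved bex /ab.
exists k.
  split=> // x kx; have [ax|nax] := pselect (moved a x); first by left.
  right; apply: contrapT => nbx; apply: kx; apply: kid => // aex.
  by apply: nbx; move/b_moved: aex; rewrite symKV.
move=> x; have [ax|/contrapT ax] := pselect (moved a x).
  rewrite (ka x)// (_ : a (e x) = e x).
    by rewrite kea//; apply: esym; apply: contrapT; exact: ab.
  by apply: contrapT => /ab; apply; exact/b_moved.
have [bx|/contrapT bx] := pselect (moved b x).
  have ay : moved a (mpbij_sym e x) by apply/b_moved; rewrite symKV.
  have := kea _ ay; rewrite symKV => ->.
  by rewrite ka; [rewrite -be symKV|exact: moved_stable].
have kx : k x = x.
  by apply: kid => [//|/b_moved]; rewrite symKV.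
by rewrite kx ax kx bx.
Qed.

(** The infinite product of the conjugations of [exchange_conj]. *)
Lemma conj_pasted (E : nat -> set T) (e a b : nat -> mpbij mu) A B :
  trivIset setT E -> (forall n, in_group (e n)) ->
  (forall n, moved (a n) `<=` E n) -> (forall n, moved (b n) `<=` E n) ->
  (forall n x, b n (e n x) = e n (a n x)) ->
  (forall n, moved (a n) `<=` ~` moved (b n)) ->
  pasted a A -> pasted b B ->
  exists2 k : mpbij mu, involution_in (\bigcup_n E n) k &
    forall x, k (A (k x)) = B x.
Proof.
move=> tE eG aE bE be ab aA bB.
have kP n : exists k : mpbij mu,
    involution_in (moved (a n) `|` moved (b n)) k /\
    forall x, k (a n (k x)) = b n x.
  by have [k] := exchange_conj (eG n) (be n) (ab n); exists k.
have {kP}[k kP] := choice kP.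
have kE n : moved (k n) `<=` E n.
  by move=> x; have [[_ _ kU] _] := kP n; move=> /kU[/aE|/bE].
have kG n : in_group (k n) by have [[]] := kP n.
have kI n : involutive (k n) by have [[]] := kP n.
have [|K [KG KI kK]] := glue_invol G_full kG kI.
  move=> n m x kn km; suff -> : n = m by [].
  by apply: tE => //; exists x; split; exact: kE.
exists K.
  by split=> // x /(moved_pasted kK)[n _ /kE Enx]; exists n.
have stable (f : nat -> mpbij mu) n x : (forall n, moved (f n) `<=` E n) ->
    E n x -> E n (f n x).
  move=> fE Ex; have [->//|fx] := pselect (f n x = x).
  by apply: fE; exact: moved_stable.
move=> x; have [[n Ex]|nE] := pselect (exists n, E n x).
  have Ekx := stable _ _ _ kE Ex.
  rewrite (pastedE tE kE kK Ex) (pastedE tE aE aA Ekx).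
  rewrite (pastedE tE kE kK (stable _ _ _ aE Ekx)) (pastedE tE bE bB Ex).
  by have [_ ->] := kP n.
have fix_x (f : nat -> mpbij mu) F : (forall n, moved (f n) `<=` E n) ->
    pasted f F -> F x = x.
  move=> fE fF; apply: contrapT => /(moved_pasted fF)[n _ /fE Ex].
  by apply: nE; exists n.
have kx := fix_x _ _ kE kK.
by rewrite kx (fix_x _ _ aE aA) kx (fix_x _ _ bE bB).
Qed.

End Swindle.

(** * Small elements are products of five small involutions *)
Section FiveInvolutions.
Context (R : realType) d (T : standardBorelType R d) (mu : probability T R).
Context (G : groupClosed (Aut mu)).
Context (G_full : full_group G) (G_ergodic : ergodic G).

Local Notation mass := (mass mu).
Local Notation in_group := (in_group G).
Local Notation involution_in := (involution_in G).

Definition copy (c f : mpbij mu) : mpbij mu :=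
  mpbij_comp c (mpbij_comp f (mpbij_sym c)).

Lemma copyE c f x : copy c f x = c (f (mpbij_sym c x)).
Proof. by []. Qed.

Lemma in_group_copy c f : in_group c -> in_group f -> in_group (copy c f).
Proof.
by move=> cG fG; do 2?apply: in_group_comp => //; exact: in_group_sym.
Qed.

Lemma moved_copy c f x : moved (copy c f) x -> moved f (mpbij_sym c x).
Proof. by move=> cx fx; apply: cx; rewrite copyE fx symKV. Qed.

Lemma trivIset_pair (sigma : nat -> nat) (E E' : nat -> set T) :
  injective sigma -> trivIset setT E -> trivIset setT E' ->
  (forall i j, E i `<=` ~` E' j) ->
  trivIset setT (fun i => E (sigma i) `|` E' i).
Proof.
move=> sigmaI tE tE' EE' i j _ _ [x [[Ei|Ei] [Ej|Ej]]].
- by apply: sigmaI; apply: tE => //; exists x.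
- by case: (EE' _ _ _ Ei Ej).
- by case: (EE' _ _ _ Ej Ei).
- by apply: tE' => //; exists x.
Qed.

(** S, H and Q are pasted from copies of the s_n, of g_(n+1) in the room E_n,
    and of g_(n+1) in the room E_(n+1).  The copy of g_0 times Q consists of
    copies of g_n = s_n g_(n+1) in E_n, hence equals S H.  Copying through
    the second family of rooms E'_n makes H and Q conjugate: K2 moves g_(n+1)
    from E_n to E'_n, and K1 moves it from E'_n to E_(n+1). *)
Lemma swindle (g s c c' : nat -> mpbij mu) (E E' : nat -> set T) :
  trivIset setT E -> trivIset setT E' -> (forall i j, E i `<=` ~` E' j) ->
  (forall n, in_group (g n)) -> (forall n, in_group (c n)) ->
  (forall n, in_group (c' n)) ->
  (forall n, involution_in (moved (g n)) (s n)) ->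
  (forall n x, g n x = s n (g n.+1 x)) ->
  (forall n, moved (g n.+1) `<=` moved (g n)) ->
  (forall n x, moved (g n) x -> E n (c n x)) ->
  (forall n x, moved (g n.+1) x -> E' n (c' n x)) ->
  let D := \bigcup_n E n `|` \bigcup_n E' n in
  exists S K1 K2 Q : mpbij mu, [/\ involution_in D S, involution_in D K1,
    involution_in D K2, in_group Q &
    forall x, copy (c 0%N) (g 0%N) (Q x) = S (K2 (K1 (Q (K1 (K2 x)))))].
Proof.
move=> tE tE' EE' gG cG c'G sP gs gg cE c'E D.
have sG n : in_group (s n) by case: (sP n).
pose cs n := copy (c n) (s n).
pose ch n := copy (c n) (g n.+1).
pose cg n := copy (c n.+1) (g n.+1).
pose c'g n := copy (c' n) (g n.+1).
have inE n x : moved (g n) (mpbij_sym (c n) x) -> E n x.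
  by move=> /cE; rewrite symKV.
have csE n : moved (cs n) `<=` E n.
  by move=> x /moved_copy sx; apply: inE; have [_ _] := sP n; exact.
have chE n : moved (ch n) `<=` E n.
  by move=> x /moved_copy gx; apply: inE; exact: gg.
have cgE n : moved (cg n) `<=` E n.+1.
  by move=> x /moved_copy gx; exact: inE.
have c'gE n : moved (c'g n) `<=` E' n.
  by move=> x /moved_copy /c'E; rewrite symKV.
have tES : trivIset setT (fun n => E n.+1).
  by move=> i j _ _ Eij; have [] := tE i.+1 j.+1 I I Eij.
have csG n : in_group (cs n) by exact: in_group_copy.
have chG n : in_group (ch n) by exact: in_group_copy.
have cgG n : in_group (cg n) by exact: in_group_copy.
have c'gG n : in_group (c'g n) by exact: in_group_copy.
have csI n : involutive (cs n).
  by move=> x; rewrite !copyE symK; have [_ -> _] := sP n; rewrite symKV.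
have [|S [SG SI Ss]] := glue_invol G_full csG csI.
  move=> n m x sn sm; suff -> : n = m by [].
  by apply: tE => //; exists x; split; exact: csE.
have [H HG Hh] := glue_disjoint G_full chG tE chE.
have [Q QG Qg] := glue_disjoint G_full cgG tES cgE.
have [Q' Q'G Q'g] := glue_disjoint G_full c'gG tE' c'gE.
have eG c1 c2 : in_group c1 -> in_group c2 ->
    in_group (mpbij_comp c2 (mpbij_sym c1)).
  by move=> c1G c2G; apply: in_group_comp => //; exact: in_group_sym.
have copy_e c1 c2 f x : copy c2 f (mpbij_comp c2 (mpbij_sym c1) x) =
    mpbij_comp c2 (mpbij_sym c1) (copy c1 f x).
  by rewrite !copyE /= !mpbijK.
have [||||K2 [K2G K2I K2D] HQ'] := conj_pasted G_full
  (trivIset_pair (@inj_id _) tE tE' EE') (fun n => eG _ _ (cG n) (c'G n))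
  _ _ _ _ Hh Q'g.
- by move=> n x /chE; left.
- by move=> n x /c'gE; right.
- by move=> n x; exact: copy_e.
- by move=> n x /chE Ex /c'gE; exact: EE' Ex.
have [||||K1 [K1G K1I K1D] QQ'] := conj_pasted G_full
  (trivIset_pair succn_inj tE tE' EE') (fun n => eG _ _ (cG n.+1) (c'G n))
  _ _ _ _ Qg Q'g.
- by move=> n x /cgE; left.
- by move=> n x /c'gE; right.
- by move=> n x; exact: copy_e.
- by move=> n x /cgE Ex /c'gE; exact: EE' Ex.
exists S, K1, K2, Q; split=> //.
- by split=> // x /(moved_pasted Ss)[n _ /csE Ex]; left; exists n.
- by split=> // x /K1D[n _ [Ex|Ex]]; [left; exists n.+1|right; exists n].
- by split=> // x /K2D[n _ [Ex|Ex]]; [left|right]; exists n.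
move=> x; rewrite QQ' -HQ' !K2I.
have cg0E : moved (copy (c 0%N) (g 0%N)) `<=` E 0%N.
  by move=> y /moved_copy; exact: inE.
have stable (f : mpbij mu) n y : moved f `<=` E n -> E n y -> E n (f y).
  move=> fE Ey; have [->//|fy] := pselect (f y = y).
  by apply: fE; exact: moved_stable.
have [[[|n] Ex]|nE] := pselect (exists n, E n x).
- have -> : Q x = x.
    apply: contrapT => /(moved_pasted Qg)[n _ /cgE Ex'].
    by have // := tE 0%N n.+1 I I (ex_intro _ x (conj Ex Ex')).
  rewrite (pastedE tE chE Hh Ex) (pastedE tE csE Ss (stable _ _ _ (chE _) Ex)).
  by rewrite !copyE symK gs.
- rewrite (pastedE tES cgE Qg Ex) (pastedE tE chE Hh Ex).
  rewrite (pastedE tE csE Ss (stable _ _ _ (chE _) Ex)).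
  have ncg : copy (c 0%N) (g 0%N) (cg n x) = cg n x.
    apply: contrapT => /cg0E E0; have := stable _ _ _ (cgE n) Ex => E1.
    by have // := tE 0%N n.+1 I I (ex_intro _ _ (conj E0 E1)).
  by rewrite ncg !copyE symK -gs.
- have Qx : Q x = x.
    apply: contrapT => /(moved_pasted Qg)[n _ /cgE Ex].
    by apply: nE; exists n.+1.
  have Hx : H x = x.
    by apply: contrapT => /(moved_pasted Hh)[n _ /chE Ex]; apply: nE; exists n.
  rewrite Qx Hx; transitivity x.
    by apply: contrapT => /cg0E Ex; apply: nE; exists 0%N.
  apply: esym; apply: contrapT => /(moved_pasted Ss)[n _ /csE Ex].
  by apply: nE; exists n.
Qed.

(** The hypothesis on g leaves outside the moved points of g two disjoint sets
    A and A' of mass three times that of these points, to be divided into the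
    two families of rooms of [swindle]. *)
Lemma five_involutions (mu_atomless : atomless mu) (g : mpbij mu) :
  in_group g -> 7 * mass (moved g) <= 1 ->
  exists D (S K1 K2 Q c : mpbij mu), [/\ measurable D /\
      mass D <= 6 * mass (moved g),
    involution_in D S, involution_in D K1 /\ involution_in D K2,
    in_group Q /\ in_group c &
    let k1 := aut_class K1 in let k2 := aut_class K2 in
    let q := aut_class Q in
    aut_class g = ((aut_class c)^-1 * (aut_class S * k2 * k1 *
      (q * k1 * q^-1) * (q * k2 * q^-1)) * aut_class c)%g].
Proof.
move=> gG g7; have b0 := mass_ge0 mu (moved g).
have mg := measurable_moved g.
have [||A [mA Ag AE]] :=
    @subset_of_mass _ _ _ _ mu_atomless (~` moved g) (3 * mass (moved g)).
- exact: measurableC.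
- by rewrite (massC mu mg); lra.
have [||A' [mA' A'A A'E]] := @subset_of_mass _ _ _ _ mu_atomless
    (~` moved g `\` A) (3 * mass (moved g)).
- by apply: measurableD => //; exact: measurableC.
- by rewrite massD// ?(massC mu mg)//; [lra|exact: measurableC].
have [E [mE EA tE E0 ES]] := rooms mu_atomless mA.
have [E' [mE' E'A tE' E'0 E'S]] := rooms mu_atomless mA'.
have [u [s [u0 uG sP us uu]]] := split_sequence G_full gG.
have u_moved n : moved (u n) `<=` moved g.
  by elim: n => [|n IH]; [rewrite u0|move=> x /(proj1 (uu n)); exact: IH].
have uE n : mass (moved (u n)) <= mass (E n) /\
    mass (moved (u n)) <= mass (E' n).
  elim: n => [|n [IH IH']]; first by rewrite u0 E0 E'0 AE A'E; split; lra.
  by have [_ le_n] := uu n; rewrite ES E'S; split; lra.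
have gE n : moved g `<=` ~` E n by move=> x gx /EA/Ag.
have gE' n : moved g `<=` ~` E' n by move=> x gx /E'A/A'A[].
have /choice[r rP] n : exists r : mpbij mu, [/\ in_group r,
    forall x, moved g x -> moved r x -> E n (r x) &
    mass (moved (u n) `\` moved r) = 0].
  have [||r [rG _ rE r0]] :=
    transport G_full G_ergodic (measurable_moved (u n)) (mE n).
  - by move=> x /u_moved; exact: gE.
  - by have [] := uE n.
  by exists r; split=> // x gx /rE[[]//|[Ex]]; case: (gE n x).
have /choice[r' r'P] n : exists r : mpbij mu, [/\ in_group r,
    forall x, moved g x -> moved r x -> E' n (r x) &
    mass (moved (u n.+1) `\` moved r) = 0].
  have [||r' [rG _ rE r0]] :=
    transport G_full G_ergodic (measurable_moved (u n.+1)) (mE' n).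
  - by move=> x /u_moved; exact: gE'.
  - have [_ le1] := uu n; have [_ le2] := uE n.
    by have := mass_ge0 mu (moved (u n)); lra.
  by exists r'; split=> // x gx /rE[[]//|[Ex]]; case: (gE' n x).
(* The transports into the rooms miss a null set of points, which is saturated
   to M; all the maps are then replaced by the identity on M. *)
pose N1 n := moved (u n) `\` moved (r n).
pose N2 n := moved (u n.+1) `\` moved (r' n).
have mN1 n : measurable (N1 n).
  by apply: measurableD; exact: measurable_moved.
have mN2 n : measurable (N2 n).
  by apply: measurableD; exact: measurable_moved.
have [||M [mM M0 NM Mu]] :=
    @saturate_null _ _ _ _ u (\bigcup_n (N1 n `|` N2 n)).
- by apply: bigcupT_measurable => n; exact: measurableU.
- apply: mass_bigcup0 => n; first exact: measurableU.
  apply/eqP; rewrite eq_le mass_ge0 andbT.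
  have := mass_leU mu (mN1 n) (mN2 n).
  by have [_ _ ->] := rP n; have [_ _ ->] := r'P n; rewrite addr0.
have Ms n x : M (s n x) <-> M x.
  by rewrite -{1}[x](symKV (u n.+1)) -us Mu -(Mu n.+1) symKV.
have mCM : measurable (~` M) by exact: measurableC.
have stableC (f : mpbij mu) : (forall x, M (f x) <-> M x) ->
    forall x, (~` M) (f x) <-> (~` M) x.
  by move=> fM x; rewrite /setC /mkset fM.
have /choice[h hP] n : exists h : mpbij mu, [/\ in_group h,
    forall x, ~ M x -> h x = u n x & forall x, M x -> h x = x].
  have [h hG [hu hid]] := restrict_stable G_full (uG n) mCM (stableC _ (Mu n)).
  by exists h; split=> // x Mx; apply: hid; exact.
have /choice[v vP] n : exists v : mpbij mu, [/\ in_group v,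
    forall x, ~ M x -> v x = s n x & forall x, M x -> v x = x].
  have [sG _ _] := sP n.
  have [v vG [vs vid]] := restrict_stable G_full sG mCM (stableC _ (Ms n)).
  by exists v; split=> // x Mx; apply: vid; exact.
have h_moved n x : moved (h n) x -> ~ M x /\ moved (u n) x.
  have [_ hu hid] := hP n => hx.
  have nM : ~ M x by move/hid.
  by split=> // ux; apply: hx; rewrite hu.
have nM_moved n x : ~ M x -> moved (u n) x -> moved (h n) x.
  by have [_ hu _] := hP n; move=> Mx; rewrite /moved /mkset hu.
have hE n x : moved (h n) x -> E n (r n x).
  move=> /h_moved[nM ux]; have [_ rE _] := rP n.
  apply: rE; first exact: u_moved ux.
  by apply: contrapT => rx; apply: nM; apply: NM; exists n => //; left.
have hE' n x : moved (h n.+1) x -> E' n (r' n x).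
  move=> /h_moved[nM ux]; have [_ rE _] := r'P n.
  apply: rE; first exact: u_moved ux.
  by apply: contrapT => rx; apply: nM; apply: NM; exists n => //; right.
have [|||||||||S [K1 [K2 [Q [SP K1P K2P QG E_swindle]]]]] :=
    @swindle h v r r' E E' tE tE'.
- by move=> i j x /EA Ax /E'A/A'A[].
- by move=> n; have [] := hP n.
- by move=> n; have [] := rP n.
- by move=> n; have [] := r'P n.
- move=> n; have [vG vs vid] := vP n; have [_ sI su] := sP n; split=> // x.
    have [Mx|nM] := pselect (M x); first by rewrite !vid.
    by rewrite (vs x)// vs ?sI//; move/Ms.
  move=> vx; have nM : ~ M x by move/vid.
  by apply: nM_moved => //; apply: su; rewrite /moved /mkset -vs.
- move=> n x; have [_ hu hid] := hP n; have [_ hu' hid'] := hP n.+1.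
  have [_ vs vid] := vP n.
  have [Mx|nM] := pselect (M x); first by rewrite hid// hid'// vid.
  rewrite (hu x nM) (hu' x nM) vs; first exact: us.
  by move=> Mux; apply: nM; exact/(Mu n.+1).
- move=> n x /h_moved[nM ux]; apply: nM_moved => //.
  exact: (proj1 (uu n)).
- exact: hE.
- exact: hE'.
set D := _ `|` _ in SP K1P K2P.
have mD : measurable D by apply: measurableU; exact: bigcupT_measurable.
exists D, S, K1, K2, Q, (r 0%N); split=> //.
- split=> //.
  have : mass D <= mass (A `|` A').
    apply: le_mass => //; first exact: measurableU.
    by move=> x [[n _ /EA]|[n _ /E'A]]; [left|right].
  by have := mass_leU mu mA mA'; lra.
- by split=> //; have [] := rP 0%N.
move=> k1 k2 q.
have gh : aut_class g = aut_class (h 0%N).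
  apply: (aut_class_null mM M0) => x nM.
  by have [_ -> //] := hP 0%N; rewrite u0.
have : aut_class (mpbij_comp (copy (r 0%N) (h 0%N)) Q) =
    aut_class (mpbij_comp S (mpbij_comp K2 (mpbij_comp K1
      (mpbij_comp Q (mpbij_comp K1 K2))))).
  exact: aut_class_ext.
rewrite /copy !aut_class_comp aut_class_sym -gh.
rewrite -/k1 -/k2 -/q => /(canRL (mulgK _)).
rewrite mulgA => /(canRL (mulgVK _)); rewrite -mulgA => /(canRL (mulKg _)) ->.
by rewrite !mulgA !mulgVK.
Qed.

End FiveInvolutions.

(** * Neighbourhoods of the identity *)
Section GroupTopology.
Context (gT : groupType) (tau : Topological gT).
Context (tau_group : group_topology tau) (tau_SIN : SIN_topology tau).

Let X : topologicalType := Topological.Pack tau.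

Let nbhsS (x : X) (A B : set X) : nbhs x A -> A `<=` B -> nbhs x B.
Proof. by move=> xA AB; exact: filterS AB xA. Qed.

Let nbhsI (x : X) (A B : set X) : nbhs x A -> nbhs x B -> nbhs x (A `&` B).
Proof. exact: filterI. Qed.

Let nbhs1 (x : X) (A : set X) : nbhs x A -> A x.
Proof. exact: nbhs_singleton. Qed.

Lemma nbhs_translate (x : gT) (A : set gT) :
  nbhs (x : X) (A : set X) <->
  nbhs (1%g : X) ([set y | A (x * y)%g] : set X).
Proof.
have [mulc _] := tau_group.
have shift (z y : gT) (B : set gT) : nbhs ((z * y)%g : X) (B : set X) ->
    nbhs (y : X) ([set w | B (z * w)%g] : set X).
  move=> zyB; have [[/= P Q] [Pz Qy] PQ] := mulc ((z : X), (y : X)) _ zyB.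
  apply: nbhsS Qy _ => w Qw; apply: (PQ (z, w)); split=> //.
  exact: nbhs1 Pz.
split=> [xA|xA]; first by apply: shift; rewrite mulg1.
have := shift x^-1%g x ([set y | A (x * y)%g]); rewrite mulVg => /(_ xA).
by move=> xA'; apply: nbhsS xA' _ => w /=; rewrite mulVKg.
Qed.

(** Continuity of the product at (1, 1), with the resulting neighbourhood made
    invariant by conjugation and then by inversion. *)
Lemma nbhs_invariant (U : set gT) : nbhs (1%g : X) (U : set X) ->
  exists V : set gT, [/\ nbhs (1%g : X) (V : set X), V `<=` U,
    forall x y, V x -> V (x ^ y)%g, forall x, V x -> V (x^-1)%g &
    forall x y, V x -> V y -> U (x * y)%g].
Proof.
have [mulc invc] := tau_group; move=> U1.
have : nbhs ((1 * 1)%g : X) (U : set X) by rewrite mulg1.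
move=> /(mulc ((1%g : X), (1%g : X)))[[/= P Q] [P1 Q1] PQ].
have [V [V1 VPQ VJ]] := tau_SIN (nbhsI P1 Q1).
have V1' : nbhs ((1^-1)%g : X) (V : set X) by rewrite invg1.
have mulU x y : V x -> V y -> U (x * y)%g.
  by move=> /VPQ[Px _] /VPQ[_ Qy]; apply: (PQ (x, y)).
exists (V `&` [set x | V (x^-1)%g]); split.
- by apply: nbhsI => //; exact: invc V1'.
- by move=> x [Vx _]; rewrite -[x]mulg1; apply: mulU => //; exact: nbhs1 V1.
- by move=> x y [Vx Vx']; split; [exact: VJ|rewrite /= -conjVg; exact: VJ].
- by move=> x [Vx Vx']; split; rewrite /= ?invgK.
- by move=> x y [Vx _] [Vy _]; exact: mulU.
Qed.

End GroupTopology.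

(** * Comparison with the uniform topology *)
Section Dichotomy.
Context (R : realType) d (T : standardBorelType R d) (mu : probability T R).
Context (mu_atomless : atomless mu).
Context (G : groupClosed (Aut mu)).
Context (G_full : full_group G) (G_ergodic : ergodic G).

Local Notation mass := (mass mu).
Local Notation in_group := (in_group G).

Definition support_mass (y : subgroup G) : R := dist_u (val y) 1%g.

Lemma support_massE y (f : mpbij mu) : val y = aut_class f ->
  support_mass y = mass (moved f).
Proof. by move=> yf; rewrite /support_mass yf dist_uE. Qed.

Lemma dist_u_mul (x y z : Aut mu) : dist_u (x * y)%g (x * z)%g = dist_u y z.
Proof.
rewrite -(aut_reprK x) -(aut_reprK y) -(aut_reprK z) -!aut_class_comp !dist_uE.
congr (fine (mu _)); apply/seteqP; split=> w /= yz.
  by move=> yzE; apply: yz; rewrite /= yzE.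
by move=> /(can_inj (symK _)).
Qed.

Lemma nbhs_uniform (x : subgroup G) (A : set (subgroup G)) :
  nbhs (x : Topological.Pack (uniform_topology G)) A <->
  exists2 e : R, 0 < e & forall y, support_mass y < e -> A (x * y)%g.
Proof.
have distE (y z : subgroup G) : dist_u (val y) (val (y * z)%g) = support_mass z.
  rewrite dist_uC -[X in dist_u _ X](mulg1 (val y)).
  exact: (dist_u_mul (val y) (val z) 1%g).
rewrite -[nbhs _ _]/(nbhs (x : uniform_group G) A); split.
  move=> /nbhs_ballP[e /= e0 eA]; exists e => // y ye.
  by apply: eA; rewrite ballEmdist /= /mdist /= distE.
move=> [e e0 eA]; apply/nbhs_ballP; exists e => // y.
rewrite ballEmdist /= /mdist /= => xy.
rewrite -[y](mulVKg x); apply: eA; rewrite -(distE x) mulVKg //.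
Qed.

Lemma support_mass1 : support_mass 1%g = 0.
Proof. exact: dist_uxx. Qed.

Lemma support_mass_gt0 y : y <> 1%g -> 0 < support_mass y.
Proof.
move=> y1; rewrite lt_neqAle mass_ge0 andbT; apply/eqP => y0.
by apply: y1; apply: val_inj; exact: dist_u_eq0.
Qed.

Lemma element_of f : in_group f -> exists x : subgroup G, val x = aut_class f.
Proof. by move=> fG; exists (exist _ (aut_class f) fG). Qed.

Lemma small_involution e : 0 < e -> exists t : mpbij mu,
  [/\ in_group t, involutive t & 0 < mass (moved t) <= e].
Proof.
move=> e0; pose c := Num.min (1 / 2) (e / 2).
have [c0 c1 ce] : [/\ 0 < c, c <= 1 / 2 & c <= e / 2].
  by rewrite /c lt_min !ge_min !lexx orbT; split=> //; lra.
have [||A [mA _ AE]] := @subset_of_mass _ _ _ _ mu_atomless setT c; first by [].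
  by rewrite mass_setT; lra.
have [||B [mB BA BE]] := @subset_of_mass _ _ _ _ mu_atomless (~` A) c.
- exact: measurableC.
- by rewrite massC//; lra.
have AB : A `<=` ~` B by move=> x Ax /BA.
have [|t [tG tI tAB tA]] := transport G_full G_ergodic mA mB AB.
  by rewrite AE BE.
have mt := measurable_moved t; exists t; split=> //; apply/andP; split.
  have : mass (A `&` moved t) <= mass (moved t).
    by apply: le_mass; [exact: measurableI| |move=> x []].
  by have := massID mu mA mt; rewrite tA; lra.
have : mass (moved t) <= mass (A `|` B).
  by apply: le_mass; [|exact: measurableU|move=> x /tAB[[]|[]]; [left|right]].
by have := mass_leU mu mA mB; lra.
Qed.

Context (tau : Topological (subgroup G)) (tau_group : group_topology tau).
Context (tau_SIN : SIN_topology tau).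

Let X : topologicalType := Topological.Pack tau.

(** A commutator of h and y is the product of a conjugate of y and of the
    inverse of y. *)
Lemma nbhs_involutions (U : set (subgroup G)) : nbhs (1%g : X) (U : set X) ->
  exists2 V : set (subgroup G), nbhs (1%g : X) (V : set X) &
    forall y x (t : mpbij mu), V y -> val x = aut_class t -> involutive t ->
      16 * mass (moved t) <= support_mass y -> U x.
Proof.
move=> /(nbhs_invariant tau_group tau_SIN)[U' [U'1 U'U U'J _ _]].
have [V [V1 _ VJ VV VU']] := nbhs_invariant tau_group tau_SIN U'1.
exists V => // y x t Vy xt tI ty.
have tG : in_group t by rewrite /in_group -xt; exact: valP.
pose g : mpbij mu := repr (val y).
have yg : val y = aut_class g by rewrite aut_reprK.
have gG : in_group g by rewrite /in_group -yg; exact: valP.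
rewrite (support_massE yg) in ty.
have [h [k [hG kG tE]]] :=
  commutator_involution G_full G_ergodic mu_atomless gG tG tI (lexx _) ty.
have [H HE] := element_of hG; have [K KE] := element_of kG.
have -> : x = ((H * y * H^-1 * y^-1) ^ K^-1)%g.
  by apply: val_inj; rewrite conjgE invgK xt tE -HE -KE -yg -[LHS]mulgA.
apply/U'U/U'J/VU'; last exact: VV.
by have := VJ _ H^-1%g Vy; rewrite conjgE invgK mulgA.
Qed.

(** Otherwise a fixed nontrivial involution of size at most e / 16 would lie in
    every neighbourhood of 1. *)
Lemma nbhs_support_mass (tau_hausdorff : hausdorff_space X) e : 0 < e ->
  nbhs (1%g : X) ([set y | support_mass y < e] : set X).
Proof.
move=> e0; have [|t [tG tI /andP[t0 te]]] := @small_involution (e / 16).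
  by lra.
have [x xt] := element_of tG.
have [U U1 nUx] : exists2 U : set X, nbhs (1%g : X) U & ~ U (x : X).
  apply: contrapT => noU.
  have : (1%g : X) = x.
    apply: tau_hausdorff => A B A1 xB.
    exists x; split; last exact: nbhs_singleton xB.
    by apply: contrapT => nAx; apply: noU; exists A.
  move=> x1; have := support_massE xt; rewrite -x1 support_mass1; lra.
have [V V1 VU] := nbhs_involutions U1.
apply: filterS V1 => y Vy; rewrite /mkset ltNge; apply/negP => ye.
by apply: nUx; apply: (VU y x t) => //; lra.
Qed.

Lemma uniform_ball_nbhs (U : set (subgroup G)) :
  ~ nbhs (1%g : X) ([set 1%g] : set X) -> nbhs (1%g : X) (U : set X) ->
  exists2 e : R, 0 < e & forall y, support_mass y < e -> U y.
Proof.
move=> tau_nondiscrete U1.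
(* Each shrinking allows one more factor, up to the five that are needed. *)
have [V1 [V11 V1U _ _ V1M]] := nbhs_invariant tau_group tau_SIN U1.
have [V2 [V21 V2V1 _ _ V2M]] := nbhs_invariant tau_group tau_SIN V11.
have [V3 [V31 V3V2 _ _ V3M]] := nbhs_invariant tau_group tau_SIN V21.
have [V [VV1 VV3 VJ _ VM]] := nbhs_invariant tau_group tau_SIN V31.
have [W W1 WV] := nbhs_involutions VV1.
have [y Wy y1] : exists2 y, W y & y <> 1%g.
  apply: contrapT => W_1; apply: tau_nondiscrete; apply: filterS W1 => y Wy.
  by apply: contrapT => y1; apply: W_1; exists y.
have y0 := support_mass_gt0 y1.
(* By [five_involutions] the factors have size at most six times the size of the
   element, and W yields involutions of size up to a sixteenth of that of y. *)
pose e := Num.min (1 / 7) (support_mass y / 96).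
have [e0 e7 e96] : [/\ 0 < e, e <= 1 / 7 & e <= support_mass y / 96].
  by rewrite /e lt_min !ge_min !lexx orbT; split=> //; lra.
exists e => // z ze.
pose g : mpbij mu := repr (val z).
have zg : val z = aut_class g by rewrite aut_reprK.
have gG : in_group g by rewrite /in_group -zg; exact: valP.
rewrite (support_massE zg) in ze.
have [|D [S [K1 [K2 [Q [c [[mD D_le] SD [K1D K2D] [QG cG] gE]]]]]]] :=
  five_involutions G_full G_ergodic mu_atomless gG; first by lra.
have inV t x : involution_in G D t -> val x = aut_class t -> V x.
  move=> [_ tI tD] xt; apply: (WV y x t Wy xt tI).
  by have := le_mass mu (measurable_moved t) mD tD; lra.
have [s sE] := element_of (let: And3 sG _ _ := SD in sG).
have [k1 k1E] := element_of (let: And3 sG _ _ := K1D in sG).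
have [k2 k2E] := element_of (let: And3 sG _ _ := K2D in sG).
have [q qE] := element_of QG; have [r rE] := element_of cG.
have Vs := inV _ _ SD sE; have Vk1 := inV _ _ K1D k1E.
have Vk2 := inV _ _ K2D k2E.
have -> : z = ((s ^ r) * (k2 ^ r) * (k1 ^ r) * (k1 ^ (q^-1 * r)) *
    (k2 ^ (q^-1 * r)))%g.
  rewrite !conjgM -!conjMg !conjgE invgK; apply: val_inj.
  by rewrite zg gE -sE -k1E -k2E -qE -rE /= !mulgA.
apply: V1M; last by apply/V2V1/V3V2/VV3; exact: VJ.
apply: V2M; last by apply/V3V2/VV3; exact: VJ.
apply: V3M; last by apply/VV3; exact: VJ.
by apply: VM; exact: VJ.
Qed.

End Dichotomy.

Theorem theorem2 (R : realType) (d : measure_display)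
  (T : standardBorelType R d) (mu : probability T R) (mu_atomless : atomless mu)
  (G : groupClosed (Aut mu)) (G_full : full_group G) (G_ergodic : ergodic G)
  (tau : Topological (subgroup G)) (tau_group : group_topology tau)
  (tau_hausdorff : hausdorff_space (Topological.Pack tau))
  (tau_SIN : SIN_topology tau) :
  open_sets tau = [set: set (subgroup G)] \/
  open_sets tau = open_sets (uniform_topology G).
Proof.
pose X : topologicalType := Topological.Pack tau.
have [disc|nondisc] := pselect (nbhs (1%g : X) ([set 1%g] : set X)).
  left; apply/seteqP; split=> // A _; rewrite /open_sets openE => x Ax.
  apply/(nbhs_translate tau_group); apply: filterS disc => y ->.
  by rewrite /mkset mulg1.
right; apply/seteqP; split=> A; rewrite /open_sets !openE => oA x Ax.
  apply/nbhs_uniform.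
  apply: (uniform_ball_nbhs mu_atomless G_full G_ergodic
    tau_group tau_SIN nondisc).
  exact: (nbhs_translate tau_group x A).1 (oA x Ax).
have [e e0 eA] := (nbhs_uniform _ _).1 (oA x Ax).
apply/(nbhs_translate tau_group).
by apply: filterS (nbhs_support_mass mu_atomless G_full G_ergodic tau_group
  tau_SIN tau_hausdorff e0).
Qed.
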